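(* Let $\beta_c:=\sqrt2$. For all $\beta>0$, the free energy $f_N(\beta)=\frac{1}{\log N}\log\sum_{x\in\mathcal X_N}e^{\beta X_x}$ of the log-correlated Gaussian field $(X_x,x\in\mathcal X_N)$ satisfies $$f(\beta):=\lim_{N\to\infty}f_N(\beta)=\begin{cases}1+\dfrac{\beta^2}{2},&\text{if }\beta<\beta_c,\\[4pt] \sqrt2\,\beta,&\text{if }\beta\ge\beta_c,\end{cases}$$ where the convergence holds almost surely and in $L^1$.
   Context: Let $[0,1]_\sim$ be the unit interval with its endpoints identified, with distance $\|x-x'\|=\min\{|x-x'|,1-|x-x'|\}$. Let $\mathcal C^+=[0,1]_\sim\times(0,\infty)$ with measure $\theta(\mathrm dx,\mathrm dy)=y^{-2}\,\mathrm dx\,\mathrm dy$. Let $\mu$ be a random measure on $\mathcal C^+$, defined on a probability space with law $\mathbb P$ and expectation $\mathbb E$, such that (i) for every measurable $A$ (with $\theta(A)<\infty$), $\mu(A)$ is a centered Gaussian variable of variance $\theta(A)$ (variance parameter $\sigma=1$), and (ii) for disjoint measurable $A_1,A_2,\dots$ the variables $\mu(A_n)$ are independent and $\mu(\bigcup_nA_n)=\sum_n\mu(A_n)$ a.s. For $u>0$ and $x\in[0,1]_\sim$ let $A_u(x)=\{(s,y)\in\mathcal C^+: y\ge u,\ -f(y)/2\le s-x\le f(y)/2\}$, where here $f(y)=y$ for $y\in(0,1/2)$ and $f(y)=1/2$ otherwise ($s-x$ is taken on the circle; this $f$ is unrelated to the free energy), and $\omega_u(x)=\mu(A_u(x))$.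 For $N\in\mathbb N$ put $\varepsilon=1/N$, $\mathcal X_N=\{0,\tfrac1N,\dots,\tfrac{N-1}N\}$, and $X_x=\omega_\varepsilon(x)$ for $x\in\mathcal X_N$. All $N$ use the same random measure $\mu$. *)

(* Defs.v *)
From HB Require Import structures.
From mathcomp Require Import all_boot all_order all_algebra.
From mathcomp Require Import all_classical all_reals all_analysis.

Set Implicit Arguments.
Unset Strict Implicit.
Unset Printing Implicit Defensive.

Import Order.TTheory GRing.Theory Num.Theory.
Import numFieldNormedType.Exports.

Local Open Scope classical_set_scope.
Local Open Scope ring_scope.

(* A point of the circle [0,1]_~ is given by its representative in [0,1[, so
   that C^+ is a measurable subset of the plane.  "s - x is taken on the
   circle" then means: up to an integer translation. *)
Definition Cplus (R : realType) : set (measurableTypeR R * measurableTypeR R) :=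
  [set z | 0 <= z.1 < 1 /\ 0 < z.2].

(* Used only for measurable A included in C^+. *)
Definition theta (R : realType)
    (A : set (measurableTypeR R * measurableTypeR R)) : \bar R :=
  (\int[(@lebesgue_measure R \x @lebesgue_measure R)%E]_(z in A)
     (z.2 ^- 2)%:E)%E.

Definition theta_finite (R : realType)
    (A : set (measurableTypeR R * measurableTypeR R)) : Prop :=
  [/\ measurable A, A `<=` Cplus (R:=R) & (theta A < +oo)%E].

(* The case v = 0 is separate because normal_prob m 0 is, by the library's
   convention, a uniform distribution and not the Dirac mass. *)
Definition centered_gaussian (R : realType) (v : R)
    (B : set (measurableTypeR R)) : \bar R :=
  if v == 0 then \d_(0 : measurableTypeR R) B
  else normal_prob 0 (Num.sqrt v) B.

Definition mutually_independent (d : measure_display) (T : measurableType d)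
    (R : realType) (P : probability T R) (X : nat -> T -> R) : Prop :=
  forall (s : seq nat) (B : nat -> set (measurableTypeR R)),
    uniq s -> (forall n, measurable (B n)) ->
    (P (\bigcap_(n in [set` s]) (X n @^-1` B n)) =
     \prod_(n <- s) P (X n @^-1` B n))%E.

(* mu A is only meaningful when theta_finite A; its other values are
   unconstrained. *)
Record gaussian_random_measure (d : measure_display) (T : measurableType d)
    (R : realType) (P : probability T R)
    (mu : set (measurableTypeR R * measurableTypeR R) -> T -> R) : Prop :=
  GaussianRandomMeasure {
    grm_measurable : forall A, theta_finite A ->
      measurable_fun [set: T] (mu A) ;
    grm_gaussian : forall A, theta_finite A ->
      forall B : set (measurableTypeR R), measurable B ->
        P (mu A @^-1` B) = centered_gaussian (fine (theta A)) B ;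
    grm_independent : forall A : nat -> set _,
      (forall n, theta_finite (A n)) -> trivIset setT A ->
      mutually_independent P (fun n => mu (A n)) ;
    grm_additive : forall A : nat -> set _,
      (forall n, theta_finite (A n)) -> trivIset setT A ->
      theta_finite (\bigcup_n A n) ->
      {ae P, forall w,
        series (fun n => mu (A n) w) @ \oo --> mu (\bigcup_n A n) w}
  }.

Definition cone_width (R : realType) (y : R) : R :=
  if y < 2^-1 then y else 2^-1.

Definition cone (R : realType) (u x : R) :
    set (measurableTypeR R * measurableTypeR R) :=
  [set z | [/\ Cplus z, u <= z.2 &
     exists k : int,
       - (cone_width z.2 / 2) <= z.1 - x + k%:~R <= cone_width z.2 / 2]].

Definition omega (T : Type) (R : realType)
    (mu : set (measurableTypeR R * measurableTypeR R) -> T -> R)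
    (u x : R) : T -> R := mu (cone u x).

(* The point x = i/N of X_N is indexed by i < N.  For N <= 1, where the
   formula is not defined, this takes a junk value. *)
Definition free_energy (T : Type) (R : realType)
    (mu : set (measurableTypeR R * measurableTypeR R) -> T -> R)
    (beta : R) (N : nat) (w : T) : R :=
  (ln N%:R)^-1 *
    ln (\sum_(i < N) expR (beta * omega mu N%:R^-1 (i%:R / N%:R) w)).

Definition beta_c (R : realType) : R := Num.sqrt 2.

Definition limit_free_energy (R : realType) (beta : R) : R :=
  if beta < beta_c R then 1 + beta ^+ 2 / 2 else Num.sqrt 2 * beta.

Definition cvg_almost_surely (d : measure_display) (T : measurableType d)
    (R : realType) (P : probability T R) (Y : nat -> T -> R) (l : R) : Prop :=
  {ae P, forall w, (fun n => Y n w) @ \oo --> l}.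

(* Integrability is required only eventually, since free_energy mu beta N is
   not meaningful for the first values of N. *)
Definition cvg_L1 (d : measure_display) (T : measurableType d)
    (R : realType) (P : probability T R) (Y : nat -> T -> R) (l : R) : Prop :=
  (\forall n \near \oo, P.-integrable [set: T] (EFin \o Y n)) /\
  (fun n => 'E_P[fun w => (`|Y n w - l|)%R]%E) @ \oo --> 0%E.

(* Main.v *)
Require Import Defs.
From HB Require Import structures.
From mathcomp Require Import all_boot all_order all_algebra.
From mathcomp Require Import all_classical all_reals all_analysis.
From mathcomp Require Import measurable_realfun.
From mathcomp Require Import zify ring lra.

Set Implicit Arguments.
Unset Strict Implicit.
Unset Printing Implicit Defensive.

Import Order.TTheory GRing.Theory Num.Theory.
Import numFieldNormedType.Exports.

Local Open Scope classical_set_scope.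
Local Open Scope ring_scope.

(** Throughout, L = ln N, X_i is the field at the site i/N and Z(b) is the sum of
exp(b X_i).

The cone of height 1/N over any point has theta-measure at most 1 + L, so the
Gaussian exponential moments give E Z(b) <= exp(b^2/2) N^(1 + b^2/2), and
Markov's inequality bounds the free energy by 1 + b^2/2 + delta outside an event
of probability at most C N^(-c).  Above the critical value this is used at
b = sqrt 2 only, with Z(beta) <= Z(b)^(beta/b) for beta >= b: the limit is the
linear continuation beta/b (1 + b^2/2) ([limit_free_energyE], [upper_tail]).

For the lower bound, cut the heights between 1/N and exp(-v) into m layers of
theta-measure v = L/(m + 1) each.  A site is good when each of its m layer
increments is at least lam v.  Above two sites at distance rho the layers of
height below rho are disjoint, hence the increments are independent there; in
the other layers the constraint on the second site is dropped.  Each increment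
is Gaussian of variance v, it exceeds lam v with probability p >=
exp(-(lam^2/2 + eta) v), and p exp(v) is large when lam < sqrt 2.  The second
moment of the number of good sites is then (1 + O(1/(p exp v))) times the
square of its mean N p^m ([many_good]).  The part of the field above height
exp(-v) has variance about v, a small fraction of L for large m, so that a union
bound over the N sites keeps it above -e L ([coarse_small]).  Together these give
a free energy of at least 1 - lam^2/2 + beta lam - delta outside an event of
probability at most C N^(-c) ([lower_tail]), and the best lam < sqrt 2 gives the
limit ([exists_slope]).

A bound C N^(-c) with small c is summable only along N = 2^k.  Between M and N
with M <= N <= 2M, each site of the coarse lattice is matched with a site of the
fine one at distance at most 1/N; the two fields then differ by Gaussian
variables of bounded variance, and a deviation by e L has probability smaller
than any power of N.  So all intermediate N are controlled almost surely
([compare_ae], [free_energy_cvg_as]).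

Convergence in mean does not go through almost sure convergence: the positive
part of f_N - f is at most a constant times Z(b) N^(-1 - b^2/2) / L, and on the
small event where f_N is too low, f_N is still at least beta X_0 / L, with
E|X_0| of order sqrt L ([free_energy_dist], [free_energy_cvg_L1]). *)

(** * Events and moments in a probability space *)

Section Probability.
Context (R : realType) (d : measure_display) (T : measurableType d)
        (P : probability T R).

Lemma measurable_le_set (f g : T -> R) :
  measurable_fun setT f -> measurable_fun setT g ->
  measurable [set z | f z <= g z].
Proof.
move=> mf mg.
have -> : [set z | f z <= g z] = setT `&` (g \- f) @^-1` `[0, +oo[%classic.
  by rewrite setTI; apply/seteqP; split => w /=; rewrite in_itv/= andbT subr_ge0.
by apply: (measurable_funB mg mf).
Qed.

Lemma measurable_lt_set (f g : T -> R) :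
  measurable_fun setT f -> measurable_fun setT g ->
  measurable [set z | f z < g z].
Proof.
move=> mf mg.
have -> : [set z | f z < g z] = setT `&` (g \- f) @^-1` `]0, +oo[%classic.
  by rewrite setTI; apply/seteqP; split => w /=; rewrite in_itv/= andbT subr_gt0.
by apply: (measurable_funB mg mf).
Qed.

Lemma ae_le_measure (A B : set T) : measurable A -> measurable B ->
  {ae P, forall w, A w -> B w} -> (P A <= P B)%E.
Proof.
move=> mA mB [N [mN PN0 sub]].
have AB : A `<=` B `|` N.
  move=> w Aw; have [Bw|nBw] := pselect (B w); first by left.
  by right; apply: sub => /=; apply/not_implyP.
apply: (le_trans (le_measure P _ _ AB)); rewrite ?inE//; first exact: measurableU.
have PN : (P N <= 0)%E by rewrite PN0.
apply: (le_trans (measureU2 P mB mN)).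
by rewrite -[leRHS]adde0; exact: leeD.
Qed.

Lemma markov_ge0 (f : T -> R) (c : R) : measurable_fun setT f ->
  (forall w, 0 <= f w) -> 0 < c ->
  (P [set w | c <= f w]%R <= (c^-1)%:E * \int[P]_w (f w)%:E)%E.
Proof.
move=> mf f0 c0.
have mA : measurable [set w | (c <= f w)%R].
  exact: (@measurable_le_set (cst c)).
rewrite lee_pdivlMl//.
have -> : (P [set w | c <= f w]%R = \int[P]_w (\1_[set w | c <= f w]%R w)%:E)%E.
  by rewrite integral_indic// setIT.
rewrite -ge0_integralZl//=; last 2 first.
- exact/measurable_EFinP/measurable_indic.
- by rewrite lee_fin ltW.
apply: ge0_le_integral => //=.
- by move=> w _; rewrite lee_fin mulr_ge0// ltW.
- by apply/measurable_EFinP/measurable_funM => //; exact/measurable_indic.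
- exact/measurable_EFinP.
- move=> w _; rewrite lee_fin indicE; case: (boolP (w \in _)) => [|_].
    by rewrite inE/= mulr1.
  by rewrite mulr0.
Qed.

(** Chebyshev's inequality for a counting variable K: the expansion of (K - m)^2 is
rearranged as (K - m)^2 + 2 m K = K^2 + m^2, an identity between nonnegative
functions, which can be integrated without integrability conditions. *)
Lemma second_moment (N : nat) (G : 'I_N -> set T) (m k : R) :
  (forall i, measurable (G i)) -> 0 < m ->
  (\sum_i P (G i) = m%:E)%E ->
  (\sum_i \sum_j P (G i `&` G j) <= (m ^+ 2 * (1 + k))%:E)%E ->
  (P [set w | \sum_i \1_(G i) w <= m / 2]%R <= (4 * k)%:E)%E.
Proof.
move=> mG m0 E1 E2.
pose K w : R := \sum_i \1_(G i) w.
have K0 w : 0 <= K w by apply: sumr_ge0 => i _.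
have mK : measurable_fun setT K.
  by apply: measurable_sum => i; exact: measurable_indic.
have iK : (\int[P]_w (K w)%:E = m%:E)%E.
  under eq_integral do rewrite -sumEFin.
  rewrite ge0_integral_sum//.
  - by rewrite -E1; apply: eq_bigr => i _; rewrite integral_indic// setIT.
  - by move=> i; exact/measurable_EFinP/measurable_indic.
have iK2 : (\int[P]_w (K w ^+ 2)%:E = \sum_i \sum_j P (G i `&` G j))%E.
  have KE w : (K w ^+ 2 = \sum_i \sum_j \1_(G i `&` G j) w)%R.
    rewrite expr2 /K mulr_suml; apply: eq_bigr => i _.
    by rewrite mulr_sumr; apply: eq_bigr => j _; rewrite indicI.
  under eq_integral do rewrite KE -sumEFin.
  rewrite ge0_integral_sum//; last 2 first.
  - move=> i; apply/measurable_EFinP; apply: measurable_sum => j.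
    by apply: measurable_indic; exact: measurableI.
  - by move=> i w _; rewrite lee_fin sumr_ge0.
  apply: eq_bigr => i _.
  under eq_integral do rewrite -sumEFin.
  rewrite ge0_integral_sum//.
  - apply: eq_bigr => j _; rewrite integral_indic// ?setIT//.
    exact: measurableI.
  - by move=> j; apply/measurable_EFinP/measurable_indic; exact: measurableI.
pose f w := ((K w - m) ^+ 2)%R.
have mf : measurable_fun setT f.
  by apply: measurable_funX; apply: measurable_funB.
have f0 w : 0 <= f w by rewrite sqr_ge0.
have key : (\int[P]_w (f w)%:E + (m *+ 2 * m)%:E =
    \int[P]_w (K w ^+ 2)%:E + (m ^+ 2)%:E)%E.
  have -> : ((m *+ 2 * m)%:E = \int[P]_w (m *+ 2 * K w)%:E)%E.
    under eq_integral do rewrite EFinM.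
    rewrite ge0_integralZl ?iK//.
    - exact/measurable_EFinP.
    - by move=> w _; rewrite lee_fin.
    - by rewrite lee_fin mulrn_wge0// ltW.
  have -> : ((m ^+ 2)%:E = \int[P]_w (m ^+ 2)%:E)%E.
    by rewrite integral_cst//= probability_setT mule1.
  have m2 : 0 <= m *+ 2 by rewrite mulrn_wge0// ltW.
  rewrite -!ge0_integralD//; last 7 first.
  - by move=> w _; rewrite lee_fin sqr_ge0.
  - exact/measurable_EFinP/measurable_funX.
  - by move=> w _; rewrite lee_fin sqr_ge0.
  - by move=> w _; rewrite lee_fin.
  - exact/measurable_EFinP.
  - by move=> w _; rewrite lee_fin mulr_ge0.
  - by apply/measurable_EFinP; apply: measurable_funM.
  by apply: eq_integral => w _; rewrite -!EFinD /f; congr EFin; ring.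
have intf : (\int[P]_w (f w)%:E <= (m ^+ 2 * k)%:E)%E.
  rewrite -(@leeD2rE _ (m *+ 2 * m)%:E)// key iK2.
  apply: (le_trans (leeD2r _ E2)); rewrite -!EFinD lee_fin.
  by rewrite le_eqVlt; apply/orP; left; apply/eqP; ring.
have sub : [set w | (K w <= m / 2)%R] `<=` [set w | (m ^+ 2 / 4 <= f w)%R].
  move=> w /= Kw; rewrite /f; have := K0 w; nra.
apply: (le_trans (le_measure P _ _ sub)); rewrite ?inE.
- exact: (@measurable_le_set _ (cst _)).
- exact: (@measurable_le_set (cst _)).
have m2 : 0 < m ^+ 2 / 4 by rewrite divr_gt0// exprn_gt0.
apply: (le_trans (markov_ge0 mf f0 m2)).
apply: (@le_trans _ _ (((m ^+ 2 / 4)^-1)%:E * (m ^+ 2 * k)%:E)%E).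
  by apply: lee_pmul => //; [rewrite lee_fin invr_ge0 ltW|apply: integral_ge0 => w _; rewrite lee_fin].
rewrite -EFinM lee_fin le_eqVlt; apply/orP; left; apply/eqP; field.
by rewrite gt_eqF.
Qed.

Lemma borel_cantelli_ae (E : nat -> set T) (C : R) :
  (forall n, measurable (E n)) ->
  (forall n, \sum_(k < n) P (E k) <= C%:E)%E ->
  {ae P, forall w, \forall n \near \oo, ~ E n w}.
Proof.
move=> mE sE.
have L0 : P (lim_sup_set E) = 0%E.
  apply: lim_sup_set_cvg0 => //; apply: (@le_lt_trans _ _ C%:E); last exact: ltry.
  apply: lime_le; first by apply: is_cvg_nneseries => n _ _; exact: measure_ge0.
  by apply: nearW => n; rewrite big_mkord; exact: sE.
exists (lim_sup_set E); split => //.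
  apply: bigcap_measurable => // k _; apply: bigcup_measurable => j _; exact: mE.
move=> w /= nw n _; apply: contrapT => nE; apply: nw.
exists n => // j /= nj Ej; apply: nE; exists j => //.
Qed.

End Probability.

(** * Gaussian variables *)

Section Density.
Local Open Scope ereal_scope.
Context (d : measure_display) (T : measurableType d) (R : realType).
Variables (mu nu : {measure set T -> \bar R}) (g : T -> R).
Hypothesis mg : measurable_fun setT g.
Hypothesis g0 : forall x, (0 <= g x)%R.
Let mEg : measurable_fun setT (EFin \o g) := measurableT_comp (@EFin_measurable _ _) mg.
Hypothesis nuE : forall A, measurable A -> nu A = \int[mu]_(x in A) (g x)%:E.

Import HBNNSimple.

Let density_nnsfun (f : {nnsfun T >-> R}) :
  \int[nu]_x (f x)%:E = \int[mu]_x ((f x)%:E * (g x)%:E).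
Proof.
under [LHS]eq_integral do rewrite fimfunE -fsumEFin//.
rewrite [LHS]ge0_integral_fsum//; last 2 first.
  - by move=> r; exact/measurable_EFinP/measurableT_comp.
  - by move=> n x _; rewrite EFinM nnfun_muleindic_ge0.
under [RHS]eq_integral.
  move=> x xD; rewrite fimfunE -fsumEFin// muleC ge0_mule_fsumr; last first.
    by move=> r; rewrite EFinM nnfun_muleindic_ge0.
  over.
rewrite [RHS]ge0_integral_fsum//; last 2 first.
  - move=> r; apply: emeasurable_funM => //.
    by apply/measurable_EFinP; apply/measurableT_comp.
  - move=> n x _; rewrite EFinM mule_ge0//.
      by rewrite lee_fin.
    by rewrite nnfun_muleindic_ge0.
apply: eq_fsbigr => r _.
rewrite integralZl_indic_nnsfun//= integral_indic// setIT nuE//.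
have [r0|r0] := leP 0%R r; last first.
  rewrite (_ : f @^-1` [set r] = set0) ?integral_set0 ?mule0.
    under eq_integral do rewrite indic0 mulr0 mule0.
    by rewrite integral0.
  apply/seteqP; split => // x /= fx; have : (0 <= f x)%R by [].
  by rewrite fx leNgt r0.
under [RHS]eq_integral => x _.
  by rewrite EFinM muleCA; over.
rewrite ge0_integralZl//; first last.
- by move=> x _; rewrite mule_ge0// lee_fin.
- apply: emeasurable_funM => //.
  by apply/measurable_EFinP; exact: measurable_indic.
congr (_ * _).
rewrite integral_mkcond; apply: eq_integral => x _.
rewrite patchE indicE; case: ifPn => _; first by rewrite mule1.
by rewrite mule0.
Qed.

(** The change of density formula for a nonnegative integrand, whose integral may
be infinite: it holds for simple functions and passes to monotone limits. *)
Lemma ge0_integral_density (f : T -> \bar R) : measurable_fun setT f ->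
  (forall x, 0 <= f x) -> \int[nu]_x f x = \int[mu]_x (f x * (g x)%:E).
Proof.
move=> mf f0.
pose f_ := nnsfun_approx measurableT mf.
transitivity (limn (fun n => \int[nu]_x (f_ n x)%:E)).
  rewrite -monotone_convergence//=.
  - apply: eq_integral => ? /[!inE] xD; apply/esym/cvg_lim => //=.
    exact: cvg_nnsfun_approx.
  - by move=> n; exact/measurable_EFinP/measurable_funTS.
  - by move=> n ? _; rewrite lee_fin.
  - by move=> ? _ ? ? mn; rewrite lee_fin; exact/lefP/nd_nnsfun_approx.
transitivity (limn (fun n => \int[mu]_x ((f_ n x)%:E * (g x)%:E))).
  by apply: congr_lim; apply/funext => n; exact: density_nnsfun.
rewrite -monotone_convergence//=.
- apply: eq_integral => x _; apply/cvg_lim => //.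
  by apply: cvgeZr => //; exact: cvg_nnsfun_approx.
- move=> n; apply: emeasurable_funM => //.
  exact/measurable_EFinP/measurable_funTS.
- by move=> n x _; rewrite mule_ge0// lee_fin.
- move=> x _ m n mn; rewrite lee_wpmul2r// lee_fin//.
  exact/lefP/nd_nnsfun_approx.
Qed.

End Density.

Section Gaussian.
Context (R : realType) (d : measure_display) (T : measurableType d)
        (P : probability T R).
Variables (X : T -> R) (v : R).
Hypothesis v0 : 0 <= v.
Hypothesis mX : measurable_fun setT X.
Hypothesis lawX : forall B : set (measurableTypeR R), measurable B ->
  P (X @^-1` B) = centered_gaussian v B.

(** Multiplying the centered Gaussian density by exp(s x) gives, up to the factor
exp(s^2 v / 2), the Gaussian density of mean s v. *)
Lemma gaussian_mgf (s : R) :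
  (\int[P]_w (expR (s * X w))%:E = (expR (s ^+ 2 * v / 2))%:E)%E.
Proof.
pose Y : T -> measurableTypeR R := X.
have mY : measurable_fun setT Y by exact: mX.
have mE : measurable_fun setT (fun x : measurableTypeR R => (expR (s * x))%:E).
  have mE : measurable_fun setT (fun x : R => (expR (s * x))%:E).
    apply/measurable_EFinP.
    exact: (measurableT_comp (@measurable_expR R) (@mulrl_measurable R setT s)).
  exact: mE.
have -> : (\int[P]_w (expR (s * X w))%:E =
   \int[pushforward P Y]_x (expR (s * x))%:E)%E.
  by rewrite ge0_integral_pushforward// => x _; rewrite lee_fin expR_ge0.
have [ve|vn0] := eqVneq v 0.
  rewrite (@eq_measure_integral _ _ _ _ (@dirac _ (measurableTypeR R) 0 R)).
    rewrite integral_dirac// diracT mul1e.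
    by rewrite ve !(mulr0,mul0r).
  by move=> A mA _; apply: (etrans (lawX mA)); rewrite /centered_gaussian ve eqxx.
have s0 : Num.sqrt v != 0 by rewrite sqrtr_eq0 -ltNge lt_neqAle eq_sym vn0.
rewrite (@eq_measure_integral _ _ _ _ (normal_prob 0 (Num.sqrt v))); last first.
  by move=> A mA _; apply: (etrans (lawX mA)); rewrite /centered_gaussian (negbTE vn0).
rewrite (@ge0_integral_density _ _ _ lebesgue_measure _ (normal_pdf 0 (Num.sqrt v)))//; last 2 first.
- exact: measurable_normal_pdf.
- by move=> x; exact: normal_pdf_ge0.
transitivity (\int[lebesgue_measure]_x ((expR (s ^+ 2 * v / 2))%:E *
    (normal_pdf (s * v) (Num.sqrt v) x)%:E))%E.
  apply: eq_integral => x _; rewrite -!EFinM; congr EFin.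
  rewrite !normal_pdfE// mulrCA [RHS]mulrCA; congr (_ * _).
  rewrite /normal_fun -!expRD sqr_sqrtr//; congr expR; field.
  done.
rewrite ge0_integralZl//; last 2 first.
- apply/measurable_EFinP; exact: measurable_normal_pdf.
- by move=> x _; rewrite lee_fin normal_pdf_ge0.
by rewrite integral_normal_pdf mule1.
Qed.

(** Stated for s X instead of X so that a negative s gives the lower tail. *)
Lemma gaussian_tail (s t : R) :
  (P [set w | t <= s * X w]%R <= (expR (s ^+ 2 * v / 2 - t))%:E)%E.
Proof.
have mf : measurable_fun setT (fun w => expR (s * X w)).
  apply: (measurableT_comp (@measurable_expR R)).
  exact: (measurableT_comp (@mulrl_measurable R setT s)).
have f0 w : 0 <= expR (s * X w) by exact: expR_ge0.
have c0 : 0 < expR t by exact: expR_gt0.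
have := markov_ge0 P mf f0 c0.
rewrite gaussian_mgf -EFinM -expRN -expRD addrC.
rewrite (_ : [set w | (expR t <= expR (s * X w))%R] = [set w | t <= s * X w])//.
by apply/seteqP; split => w /=; rewrite ler_expR.
Qed.

(** The density is decreasing on [t, t + sqrt v], an interval one standard deviation
long. *)
Lemma gaussian_tail_ge (t : R) : 0 < v -> 0 <= t ->
  (((Num.sqrt (pi *+ 2))^-1 * expR (- (t + Num.sqrt v) ^+ 2 / (v *+ 2)))%:E
   <= P [set w | t <= X w]%R)%E.
Proof.
move=> vgt0 t0.
have s0 : 0 < Num.sqrt v by rewrite sqrtr_gt0.
have -> : [set w | t <= X w] = X @^-1` `[t, +oo[%classic.
  by apply/seteqP; split => w /=; rewrite in_itv/= andbT.
rewrite lawX// /centered_gaussian gt_eqF// /normal_prob.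
have [c cE] : exists c : R, c = (Num.sqrt (pi *+ 2))^-1 *
  expR (- (t + Num.sqrt v) ^+ 2 / (v *+ 2)) by eexists.
rewrite -cE.
have c0 : 0 <= c by rewrite cE mulr_ge0 ?expR_ge0// invr_ge0 sqrtr_ge0.
have h1 : (c%:E <= \int[lebesgue_measure]_(x in `[t, (t + Num.sqrt v)%R])
   (c / Num.sqrt v)%:E)%E.
  rewrite integral_cst//= lebesgue_measure_itv/= lte_fin ltrDl s0 -EFinD.
  by rewrite addrC addKr -EFinM divfK// gt_eqF.
apply: (le_trans h1).
have h2 : (\int[lebesgue_measure]_(x in `[t, (t + Num.sqrt v)%R])
   (c / Num.sqrt v)%:E <= \int[lebesgue_measure]_(x in `[t, (t + Num.sqrt v)%R])
   (normal_pdf 0 (Num.sqrt v) x)%:E)%E.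
  apply: ge0_le_integral => //=.
  - move=> x _; rewrite lee_fin divr_ge0 ?sqrtr_ge0//.
  - by apply/measurable_EFinP/measurable_funTS; exact: measurable_normal_pdf.
  - move=> x; rewrite in_itv/= => /andP[tx xt].
    rewrite lee_fin normal_pdfE ?gt_eqF// cE /normal_peak /normal_fun.
    rewrite sqr_sqrtr// subr0 -mulrnAr sqrtrM// invfM mulrC mulrA.
    rewrite ler_pM2l; last first.
      by rewrite mulr_gt0// invr_gt0// sqrtr_gt0 pmulrn_lgt0// pi_gt0.
    rewrite ler_expR ler_pM2r ?invr_gt0 ?pmulrn_lgt0// lerN2.
    by rewrite lerXn2r// nnegrE ?(le_trans t0)// (le_trans tx).
apply: (le_trans h2).
apply: ge0_subset_integral => //=.
- by apply/measurable_EFinP/measurable_funTS; exact: measurable_normal_pdf.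
- by move=> x _; rewrite lee_fin normal_pdf_ge0.
- by apply: subset_itvl.
Qed.

End Gaussian.

(** * Geometry of the cones *)

Section Slice.
Context (R : realType).
Implicit Types (x w s y u a b c : R).

(** The horizontal section at a given height of the cones over x, where w is the
width of the cones at that height. *)
Definition slice x w : set (measurableTypeR R) :=
  [set s : R | 0 <= s < 1 /\ exists k : int, - (w / 2) <= s - x + k%:~R <= w / 2].

Lemma small_int (k : int) : - 2 < (k%:~R : R) < 2 -> [\/ k = 0, k = 1 | k = -1].
Proof.
have -> : (2 : R) = 2%:~R by [].
rewrite -mulrNz ltr_int ltr_int => /andP[k1 k2].
have [->|[->|->]] : k = 0 \/ k = 1 \/ k = -1 by lia.
- exact: Or31.
- exact: Or32.
- exact: Or33.
Qed.

Lemma sliceP x w s : 0 <= x < 1 -> 0 <= w < 1 ->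
  slice x w s <-> 0 <= s < 1 /\ [\/ x - w / 2 <= s <= x + w / 2,
     x - w / 2 <= s + 1 <= x + w / 2 | x - w / 2 <= s - 1 <= x + w / 2].
Proof.
move=> x01 w01; split=> -[s01].
  move=> [k kk]; split => //.
  have kb : - 2 < (k%:~R : R) < 2 by lra.
  have [k0|k0|k0] := small_int kb; move: kk; rewrite k0 => kk.
  - by apply: Or31; lra.
  - by apply: Or32; lra.
  - by apply: Or33; lra.
by case=> h; split => //; [exists 0|exists 1|exists (-1)]; lra.
Qed.

Lemma itv_cc_meas a b : a <= b ->
  lebesgue_measure (`[a, b]%classic : set (measurableTypeR R)) = (b - a)%:E.
Proof.
move=> ab; rewrite lebesgue_measure_itv/= lte_fin lt_neqAle ab andbT.
by case: eqVneq => [->|_] /=; rewrite ?subrr// -EFinB.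
Qed.

Lemma itv_co_meas a b : a <= b ->
  lebesgue_measure (`[a, b[%classic : set (measurableTypeR R)) = (b - a)%:E.
Proof.
move=> ab; rewrite lebesgue_measure_itv/= lte_fin lt_neqAle ab andbT.
by case: eqVneq => [->|_] /=; rewrite ?subrr// -EFinB.
Qed.

(** Since w < 1, the arc wraps around at most one end of [0, 1[; the three cases are
a wrap on the left, a wrap on the right, and none. *)
Lemma slice_meas x w : 0 <= x < 1 -> 0 <= w < 1 ->
  measurable (slice x w) /\ lebesgue_measure (slice x w) = w%:E.
Proof.
move=> x01 w01.
have [xl|xl] := ltP (x - w / 2) 0.
  have -> : slice x w = `[0, x + w / 2]%classic `|` `[1 + x - w / 2, 1[%classic.
    apply/seteqP; split => s.
      move/(sliceP s x01 w01) => [s01 [h|h|h]]; rewrite /= !in_itv/=;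
        (by left; lra) || (by right; lra).
    move=> h; apply/(sliceP s x01 w01); move: h => [] /=; rewrite in_itv/= => h.
      by split; [lra|apply: Or31; lra].
    by split; [lra|apply: Or33; lra].
  split; first exact: measurableU.
  rewrite measureU//; first last.
    apply/seteqP; split => s //= []; rewrite !in_itv/= => h1 h2; lra.
  by rewrite /= itv_cc_meas ?itv_co_meas; [rewrite -EFinD; congr EFin; lra|lra|lra].
have [xr|xr] := leP 1 (x + w / 2).
  have -> : slice x w = `[0, x + w / 2 - 1]%classic `|` `[x - w / 2, 1[%classic.
    apply/seteqP; split => s.
      move/(sliceP s x01 w01) => [s01 [h|h|h]]; rewrite /= !in_itv/=;
        (by left; lra) || (by right; lra).
    move=> h; apply/(sliceP s x01 w01); move: h => [] /=; rewrite in_itv/= => h.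
      by split; [lra|apply: Or32; lra].
    by split; [lra|apply: Or31; lra].
  split; first exact: measurableU.
  rewrite measureU//; first last.
    apply/seteqP; split => s //= []; rewrite !in_itv/= => h1 h2; lra.
  by rewrite /= itv_cc_meas ?itv_co_meas; [rewrite -EFinD; congr EFin; lra|lra|lra].
have -> : slice x w = `[x - w / 2, x + w / 2]%classic.
  apply/seteqP; split => s.
    move/(sliceP s x01 w01) => [s01 [h|h|h]]; rewrite /= !in_itv/=; lra.
  rewrite /= in_itv/= => h; apply/(sliceP s x01 w01).
  by split; [lra|apply: Or31; lra].
by split => //; rewrite itv_cc_meas; [congr EFin; lra|lra].
Qed.

(** The arc of width w around x lies in the arc of width w + 2h around x', which
itself contains the arc of width w around x'. *)
Lemma slice_diff x x' w (h : R) : 0 <= x < 1 -> 0 <= x' < 1 -> 0 <= w ->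
  `|x - x'| <= h -> w + 2 * h < 1 ->
  (lebesgue_measure (slice x w `\` slice x' w) <= (2 * h)%:E)%E.
Proof.
move=> x01 x01' w0 xx wh.
have h0 : 0 <= h by apply: le_trans xx.
have w1 : 0 <= w < 1 by lra.
have wh1 : 0 <= w + 2 * h < 1 by lra.
have [m1 l1] := slice_meas x01 w1.
have [m2 l2] := slice_meas x01' w1.
have [m3 l3] := slice_meas x01' wh1.
have sub1 : slice x w `\` slice x' w `<=` slice x' (w + 2 * h) `\` slice x' w.
  move=> s [[s01 [k kk]] ns]; split => //; split => //; exists k.
  by move: xx; rewrite ler_norml => xx; lra.
have sub2 : slice x' w `<=` slice x' (w + 2 * h).
  by move=> s [s01 [k kk]]; split => //; exists k; lra.
apply: (le_trans (le_measure lebesgue_measure _ _ sub1)).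
- by rewrite inE; exact: measurableD.
- by rewrite inE; exact: measurableD.
rewrite measureD//; last by rewrite /= l3 ltry.
have -> : slice x' (w + 2 * h) `&` slice x' w = slice x' w.
  by apply/seteqP; split => s; [case|move=> hs; split => //; exact: sub2].
by rewrite /= l2 l3 -EFinB lee_fin; lra.
Qed.

End Slice.

Section ConeSets.
Context (R : realType).
Implicit Types (x w s y u a b c : R).
Notation RR := (measurableTypeR R).

Lemma coneE u x (z : RR * RR) : 0 < u ->
  cone u x z <-> u <= z.2 /\ slice x (cone_width z.2) z.1.
Proof.
move=> u0; split.
  by move=> [[z1 z2] uz [k kk]]; split => //; split => //; exists k.
move=> [uz [s01 [k kk]]]; split => //; last by exists k.
by split => //; exact: lt_le_trans uz.
Qed.

Lemma measurable_cone_width : measurable_fun (@setT R) (@cone_width R).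
Proof.
apply: measurable_fun_ifT => //.
by apply: measurable_fun_ltr.
Qed.

Let mfst : measurable_fun (@setT (RR * RR)) (fun z : RR * RR => z.1 : R).
Proof. exact: (@measurable_fst _ _ RR RR). Qed.
Let msnd : measurable_fun (@setT (RR * RR)) (fun z : RR * RR => z.2 : R).
Proof. exact: (@measurable_snd _ _ RR RR). Qed.

Lemma measurable_cone u x : measurable (cone u x : set (RR * RR)).
Proof.
have mcst (r : R) : measurable_fun (@setT (RR * RR)) (fun _ : RR * RR => r) by exact: measurable_cst.
have mw : measurable_fun (@setT (RR * RR)) (fun z : RR * RR => cone_width (z.2 : R) / 2).
  apply: measurable_funM => //.
  exact: (measurableT_comp measurable_cone_width msnd).
have -> : (cone u x : set (RR * RR)) =
  ([set z : RR * RR | (0 <= z.1 :> R)] `&` [set z : RR * RR | (z.1 < 1 :> R)]) `&`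
  [set z : RR * RR | (0 < z.2 :> R)] `&` [set z : RR * RR | (u <= z.2 :> R)] `&`
  \bigcup_(k : int) ([set z : RR * RR | (- (cone_width (z.2 : R) / 2) <= (z.1 : R) - x + k%:~R)] `&`
    [set z : RR * RR | ((z.1 : R) - x + k%:~R <= cone_width (z.2 : R) / 2)]).
  apply/seteqP; split => z.
    move=> [[/andP[z0 z1] z2] uz [k /andP[k1 k2]]]; split; first by split; [split; [split|]|].
    by exists k.
  move=> [[[[z0 z1] z2] uz] [k _ [k1 k2]]].
  split => //; first by split => //; apply/andP.
  by exists k; apply/andP.
have mk (k : int) : measurable_fun (@setT (RR * RR)) (fun z : RR * RR => (z.1 : R) - x + k%:~R).
  by apply: measurable_funD => //; apply: measurable_funB.
apply: measurableI; last first.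
  apply: countable_bigcupT_measurable => // k.
  apply: measurableI; last exact: measurable_le_set.
  by apply: measurable_le_set => //; exact: measurable_funN.
apply: measurableI; last exact: measurable_le_set.
apply: measurableI; last exact: measurable_lt_set.
by apply: measurableI; [exact: measurable_le_set|exact: measurable_lt_set].
Qed.

End ConeSets.

(** * The measure theta of cones and strips *)

Section Calculus.
Context (R : realType).
Implicit Types (x w s y u a b c : R).

(** The function is discontinuous at 0; it is the power -1 of y^2, both conventions
giving 0 at 0. *)
Lemma measurable_inv_sqr : measurable_fun (@setT R) (fun y : R => y ^- 2).
Proof.
have -> : (fun y : R => y ^- 2) = (fun y => (y ^+ 2) `^ (-1)).
  by apply/funext => y; rewrite powR_inv1// sqr_ge0.
apply: (@measurableT_comp _ _ _ _ _ _ (@powR R ^~ (-1))).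
  exact: measurable_powR.
exact: exprn_measurable.
Qed.

Lemma measurable_invr : measurable_fun `]0 : R, +oo[%classic (fun y : R => y^-1).
Proof.
apply: (eq_measurable_fun (fun y => y `^ (-1))).
  by move=> y; rewrite inE/= in_itv/= andbT => y0; rewrite powR_inv1// ltW.
by apply: measurable_funTS; exact: measurable_powR.
Qed.

Lemma cvg_inv y : y != 0 -> (fun z : R => z^-1) z @[z --> y] --> y^-1.
Proof. by move=> y0; exact: (@inv_continuous R y). Qed.

Lemma integral_inv_sqr u c : 0 < u -> 0 <= c ->
  (\int[lebesgue_measure]_(y in `[u, +oo[) (c * y ^- 2)%:E = (c / u)%:E)%E.
Proof.
move=> u0 c0.
have dF y : u <= y -> is_derive y 1 (fun y => - c * y^-1 : R) (c * y ^- 2).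
  move=> uy; have y0 : y != 0 by rewrite gt_eqF// (lt_le_trans u0).
  have dV : is_derive y 1 (fun y : R => y^-1) (- y ^- 2 *: 1).
    exact: (@is_deriveV R id y 1 1).
  have := is_deriveZ (- c) dV.
  move=> h; apply: (is_derive_eq h).
  by rewrite /GRing.scale/=; lra.
have cF y : u <= y -> (fun y => - c * y^-1 : R) z @[z --> y] --> - c * y^-1.
  move=> uy; apply: cvgM; first exact: cvg_cst.
  by apply: cvg_inv; rewrite gt_eqF// (lt_le_trans u0).
have cf y : u <= y -> (fun y => c * y ^- 2 : R) z @[z --> y] --> c * y ^- 2.
  move=> uy; apply: cvgM; first exact: cvg_cst.
  have y0 : y != 0 by rewrite gt_eqF// (lt_le_trans u0).
  apply: (@cvgV R); first by rewrite expf_neq0.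
  exact: (@exprn_continuous R 2 y).
rewrite (@ge0_continuous_FTC2y _ _ (fun y => - c * y^-1) _ 0).
- by rewrite sub0e -EFinN; congr EFin; lra.
- by move=> y uy; rewrite mulr_ge0// invr_ge0 sqr_ge0.
- apply/continuous_within_itvcyP; split.
    by move=> y; rewrite in_itv/= andbT => uy; exact: cf (ltW uy).
  apply: cvg_at_right_filter; exact: cf.
- rewrite -[0](mulr0 (- c)); apply: cvgM; first exact: cvg_cst.
  by apply/gtr0_cvgV0; [near=> y|exact: cvg_id].
- by move=> y uy; have [] := dF _ (ltW uy).
- by apply: cvg_at_right_filter; exact: cF.
- by move=> y; rewrite in_itv/= andbT => uy; rewrite derive1E; have [_ ->] := dF _ (ltW uy).
Unshelve. all: by end_near. Qed.

Lemma integral_invr_itv a b : 0 < a -> a < b ->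
  (\int[lebesgue_measure]_(y in `[a, b]) (y^-1)%:E = (ln b - ln a)%:E)%E.
Proof.
move=> a0 ab.
have d0 y : a <= y -> is_derive y 1 (@ln R) (y^-1).
  by move=> ay; apply: is_derive1_ln; exact: lt_le_trans ay.
have c0 y : a <= y -> (@ln R) z @[z --> y] --> ln y.
  by move=> ay; apply: continuous_ln; exact: lt_le_trans ay.
have cv y : a <= y -> (fun z : R => z^-1) z @[z --> y] --> y^-1.
  by move=> ay; apply: cvg_inv; rewrite gt_eqF// (lt_le_trans a0).
rewrite (@continuous_FTC2 _ _ (@ln R))//.
- apply/continuous_within_itvP => //; split.
  + by move=> y; rewrite in_itv/= => /andP[ay _]; exact: cv (ltW ay).
  + by apply: cvg_at_right_filter; exact: cv.
  + by apply: cvg_at_left_filter; exact: cv (ltW ab).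
- split.
  + by move=> y; rewrite in_itv/= => /andP[ay _]; have [] := d0 _ (ltW ay).
  + by apply: cvg_at_right_filter; exact: c0.
  + by apply: cvg_at_left_filter; exact: c0 (ltW ab).
- by move=> y; rewrite in_itv/= => /andP[ay _]; rewrite derive1E; have [_ ->] := d0 _ (ltW ay).
Qed.

End Calculus.

Section Theta.
Context (R : realType).
Implicit Types (x w s y u a b c : R).
Notation RR := (measurableTypeR R).

Lemma measurable_weight :
  measurable_fun (@setT (RR * RR)) (fun z : RR * RR => (z.2 : R) ^- 2).
Proof. exact: (measurableT_comp (@measurable_inv_sqr R) (@measurable_snd _ _ RR RR)). Qed.

(** Tonelli: theta is the integral over the height y of y^-2 times the length of the
horizontal section. *)
Lemma theta_ysection (A : set (RR * RR)) : measurable A ->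
  theta A = (\int[lebesgue_measure]_y
    ((y ^- 2)%:E * lebesgue_measure (ysection A y)))%E.
Proof.
move=> mA; rewrite /theta integral_mkcond.
have mf : measurable_fun setT
    (fun z : RR * RR => ((z.2 ^- 2 * \1_A z : R))%:E).
  apply/measurable_EFinP; apply: measurable_funM; last exact: measurable_indic.
  exact: measurable_weight.
transitivity (\int[(@lebesgue_measure R \x @lebesgue_measure R)%E]_z
   ((z.2 ^- 2 * \1_A z : R))%:E)%E.
  apply: eq_integral => z _; rewrite patchE indicE.
  by case: ifPn => _; rewrite ?mulr1 ?mulr0.
rewrite fubini_tonelli2//; last first.
  by move=> z; rewrite lee_fin mulr_ge0// invr_ge0 sqr_ge0.
apply: eq_integral => y _.
rewrite /fubini_G /=.
under eq_integral do rewrite EFinM.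
rewrite ge0_integralZl//.
- congr (_ * _)%E.
  have := @indic_fubini_tonelli_GE _ _ RR RR R lebesgue_measure A mA.
  by move=> /(congr1 (fun g => g y)).
- apply/measurable_EFinP.
  have -> : (fun s : RR => \1_A (s, y) : R) = \1_(ysection A y).
    by apply/funext => s; rewrite !indicE mem_ysection.
  by apply: measurable_indic; exact: measurable_ysection.
- by rewrite lee_fin invr_ge0 sqr_ge0.
Qed.

Lemma theta_setU (A B : set (RR * RR)) : measurable A -> measurable B ->
  A `&` B = set0 -> (theta (A `|` B) = theta A + theta B)%E.
Proof.
move=> mA mB AB0; rewrite /theta ge0_integral_setU//.
- apply/measurable_EFinP; apply: measurable_funTS; exact: measurable_weight.
- by move=> z _; rewrite lee_fin invr_ge0 sqr_ge0.
- by apply/disj_setPS; rewrite AB0.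
Qed.

Lemma theta_ge0 (A : set (RR * RR)) : (0 <= theta A)%E.
Proof. by apply: integral_ge0 => z _; rewrite lee_fin invr_ge0 sqr_ge0. Qed.

(** The integral of c y^-2 over [u, +oo[ is c / u. *)
Lemma theta_le_section (A : set (RR * RR)) u c : measurable A -> 0 < u -> 0 <= c ->
  (forall y : R, u <= y -> (lebesgue_measure (ysection A (y : RR)) <= c%:E)%E) ->
  (forall z, A z -> u <= z.2) ->
  (theta A <= (c / u)%:E)%E.
Proof.
move=> mA u0 c0 Ac Au; rewrite theta_ysection// -integral_inv_sqr//.
rewrite [leLHS](_ : _ = \int[lebesgue_measure]_(y in `[u, +oo[)
    ((y ^- 2)%:E * lebesgue_measure (ysection A y)))%E; last first.
  rewrite [RHS]integral_mkcond; apply: eq_integral => y _.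
  rewrite patchE; case: ifPn => //.
  rewrite notin_setE/= in_itv/= andbT => yu.
  rewrite (_ : ysection A y = set0) ?measure0 ?mule0//.
  by apply/seteqP; split => // s /=; rewrite ysectionE => /Au.
apply: ge0_le_integral => //=.
- by move=> y _; rewrite mule_ge0// lee_fin invr_ge0 sqr_ge0.
- apply: emeasurable_funM.
    by apply/measurable_EFinP/measurable_funTS; exact: measurable_inv_sqr.
  by apply: measurable_funTS; exact: measurable_fun_ysection.
- apply/measurable_EFinP/measurable_funTS; apply: measurable_funM => //.
  exact: measurable_inv_sqr.
- move=> y; rewrite in_itv/= andbT => uy.
  by rewrite mulrC EFinM; apply: lee_wpmul2l; rewrite ?lee_fin ?invr_ge0 ?sqr_ge0//; exact: Ac.
Qed.

End Theta.

Section Strips.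
Context (R : realType).
Implicit Types (x w s y u a b c h : R).
Notation RR := (measurableTypeR R).

Definition strip a b x : set (RR * RR) := cone a x `\` cone b x.

Lemma cone_width_bound y : 0 < y ->
  [/\ 0 <= cone_width y, cone_width y <= 2^-1 & cone_width y <= y].
Proof. by rewrite /cone_width => y0; case: ltP => h; split; lra. Qed.

Lemma measurable_strip a b x : measurable (strip a b x).
Proof. by apply: measurableD; exact: measurable_cone. Qed.

Lemma stripE a b x (z : RR * RR) : 0 < a -> 0 < b ->
  strip a b x z <-> (a <= z.2 < b) /\ slice x (cone_width z.2) z.1.
Proof.
move=> a0 b0; split.
  move=> [/(coneE _ _ a0)[az sz] nb]; split => //.
  rewrite az /= ltNge; apply/negP => bz; apply: nb.
  by apply/(coneE _ _ b0).
move=> [/andP[az zb] sz]; split; first exact/(coneE _ _ a0).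
by move=> /(coneE _ _ b0)[bz _]; move: zb; rewrite ltNge bz.
Qed.

Lemma ysection_strip a b x y : 0 < a -> 0 < b -> a <= y < b ->
  ysection (strip a b x) (y : RR) = slice x (cone_width y).
Proof.
move=> a0 b0 ayb; apply/seteqP; split => s; rewrite ysectionE /=.
  by move/(stripE _ _ a0 b0) => [].
by move=> h; apply/(stripE _ _ a0 b0).
Qed.

Lemma ysection_strip0 a b x y : 0 < a -> 0 < b -> ~ (a <= y < b) ->
  ysection (strip a b x) (y : RR) = set0.
Proof.
move=> a0 b0 ayb; apply/seteqP; split => s //; rewrite ysectionE /=.
by move/(stripE _ _ a0 b0) => [].
Qed.

(** Below height 1/2 the section at height y has length y, and the integral of
y^-2 y over [a, b[ is ln b - ln a. *)
Lemma theta_strip a b x : 0 <= x < 1 -> 0 < a -> a < b -> b <= 2^-1 ->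
  theta (strip a b x) = (ln b - ln a)%:E.
Proof.
move=> x01 a0 ab b2; have b0 : 0 < b by lra.
rewrite theta_ysection; last exact: measurable_strip.
rewrite -integral_invr_itv//.
rewrite -integral_itv_bndo_bndc; last first.
  apply/measurable_EFinP; apply: (@measurable_funS _ _ RR _ `]0 : R, +oo[%classic) => //.
    by move=> y /=; rewrite !in_itv/= andbT; lra.
  exact: measurable_invr.
rewrite [RHS]integral_mkcond; apply: eq_integral => y _.
rewrite patchE; case: ifPn => [|].
  rewrite inE/= in_itv/= => ayb; rewrite ysection_strip//.
  have y0 : 0 < y by lra.
  have -> : cone_width y = y by rewrite /cone_width; case: ltP => // ?; lra.
  have [_ ->] := @slice_meas R x y x01 ltac:(lra).
  by rewrite -EFinM; congr EFin; field; rewrite gt_eqF.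
rewrite notin_setE/= in_itv/= => ayb.
by rewrite ysection_strip0// measure0 mule0.
Qed.

Lemma ysection_cone u x y : 0 < u -> u <= y ->
  ysection (cone u x) (y : RR) = slice x (cone_width y).
Proof.
move=> u0 uy; apply/seteqP; split => s; rewrite ysectionE /=.
  by move/(coneE _ _ u0) => [].
by move=> h; apply/(coneE _ _ u0).
Qed.

Lemma theta_cone_half x : 0 <= x < 1 -> (theta (cone 2^-1 x : set (RR * RR)) <= 1)%E.
Proof.
move=> x01.
have -> : (1 = (2^-1 / 2^-1 : R)%:E)%E by congr EFin; field.
apply: theta_le_section => //.
- exact: measurable_cone.
- move=> y y2; rewrite ysection_cone//.
  have [h0 h1 h2] := @cone_width_bound y ltac:(lra).
  by have [_ ->] := @slice_meas R x (cone_width y) x01 ltac:(lra); rewrite lee_fin.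
- by move=> z [].
Qed.

(** The cone is the strip below height 1/2 and the cone above it, which has measure
at most 1 because its sections have length 1/2. *)
Lemma theta_cone_le u x : 0 <= x < 1 -> 0 < u -> u <= 2^-1 ->
  (theta (cone u x : set (RR * RR)) <= (1 - ln u)%:E)%E.
Proof.
move=> x01 u0; rewrite le_eqVlt => /orP[/eqP ->|u2].
  apply: (le_trans (theta_cone_half x01)); rewrite lee_fin.
  have : ln (2^-1 : R) <= 0 by apply: ln_le0; lra.
  lra.
have sub : (cone 2^-1 x : set (RR * RR)) `<=` cone u x.
  by move=> z [h1 h2 h3]; split => //; lra.
have -> : (cone u x : set (RR * RR)) = strip u 2^-1 x `|` cone 2^-1 x.
  by rewrite /strip setUC setDUK.
rewrite theta_setU; last 3 first.
- exact: measurable_strip.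
- exact: measurable_cone.
- by rewrite /strip setIC setDIK.
rewrite theta_strip//.
apply: (le_trans (leeD2l _ (theta_cone_half x01))).
rewrite -EFinD lee_fin.
have : ln (2^-1 : R) <= 0 by apply: ln_le0; lra.
lra.
Qed.

(** At a height where both cones are present, their sections are arcs of the same
width and nearby centers; below the base u' of the second cone, the sections of
the first one have width less than u'. *)
Lemma theta_cone_diff u u' x x' h c : 0 <= x < 1 -> 0 <= x' < 1 ->
  0 < u -> 0 < u' -> `|x - x'| <= h -> h < 4^-1 -> 2 * h <= c -> u' <= c ->
  (theta ((cone u x : set (RR * RR)) `\` cone u' x') <= (c / u)%:E)%E.
Proof.
move=> x01 x01' u0 u0' xx h4 hc uc.
apply: theta_le_section => //.
- by apply: measurableD; exact: measurable_cone.
- by lra.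
- move=> y uy; have y0 : 0 < y by lra.
  have [w0 w1 w2] := cone_width_bound y0.
  have [uy'|uy'] := leP u' y.
    apply: (@le_trans _ _ (2 * h)%:E); last by rewrite lee_fin.
    apply: (le_trans _ (@slice_diff R x x' (cone_width y) h x01 x01' w0 xx ltac:(lra))).
    rewrite (_ : ysection _ _ = slice x (cone_width y) `\` slice x' (cone_width y))//.
    by rewrite -(@ysection_cone u x y)// -(@ysection_cone u' x' y)// ysectionD.
  have [m1 l1] := @slice_meas R x (cone_width y) x01 ltac:(lra).
  apply: (@le_trans _ _ (lebesgue_measure (slice x (cone_width y)))).
    apply: le_measure; rewrite ?inE//.
      by apply: measurable_ysection; apply: measurableD; exact: measurable_cone.
    rewrite -(@ysection_cone u x y)//.
    by move=> s; rewrite !ysectionE => -[].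
  by rewrite l1 lee_fin; lra.
- by move=> z [[]].
Qed.

Lemma cone_finite u x : 0 <= x < 1 -> 0 < u -> theta_finite (cone u x : set (RR * RR)).
Proof.
move=> x01 u0; split; first exact: measurable_cone.
  by move=> z [].
apply: (@le_lt_trans _ _ (2^-1 / u)%:E); last exact: ltry.
apply: theta_le_section => //; first exact: measurable_cone.
- move=> y uy; rewrite ysection_cone//.
  have [h0 h1 h2] := @cone_width_bound y ltac:(lra).
  by have [_ ->] := @slice_meas R x (cone_width y) x01 ltac:(lra); rewrite lee_fin.
- by move=> z [].
Qed.

Lemma sub_theta_finite (A B : set (RR * RR)) : measurable A -> A `<=` B ->
  theta_finite B -> theta_finite A.
Proof.
move=> mA AB [mB BC Bfin]; split => //; first exact: subset_trans BC.
apply: le_lt_trans Bfin; rewrite /theta; apply: ge0_subset_integral => //.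
- by apply/measurable_EFinP/measurable_funTS; exact: measurable_weight.
- by move=> z _; rewrite lee_fin invr_ge0 sqr_ge0.
Qed.

Lemma strip_finite a b x : 0 <= x < 1 -> 0 < a -> theta_finite (strip a b x).
Proof.
move=> x01 a0; apply: sub_theta_finite (cone_finite x01 a0).
  exact: measurable_strip.
exact: subDsetl.
Qed.

Lemma theta0 : theta (set0 : set (RR * RR)) = 0%E.
Proof. by rewrite /theta integral_set0. Qed.

Lemma set0_finite : theta_finite (set0 : set (RR * RR)).
Proof. by split => //; rewrite theta0 ltry. Qed.

Lemma strip_disjoint_level a b a' b' x x' : 0 < a -> b <= a' ->
  0 < b -> 0 < b' ->
  strip a b x `&` strip a' b' x' = set0.
Proof.
move=> a0 ba b0 b0'; apply/seteqP; split => z // -[].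
move=> /(stripE _ _ a0 b0)[h1 _] /(stripE _ _ (lt_le_trans b0 ba) b0')[h2 _].
lra.
Qed.

(** A strip below height r has sections of width less than r, too narrow to meet
when the centers are at circular distance at least r. *)
Lemma strip_disjoint_far a b x x' r : 0 < a -> 0 < b -> b <= r ->
  0 <= x < 1 -> 0 <= x' < 1 ->
  (forall k : int, r <= `|x - x' + k%:~R|) ->
  strip a b x `&` strip a b x' = set0.
Proof.
move=> a0 b0 br x01 x01' far; apply/seteqP; split => z // -[].
move=> /(stripE _ _ a0 b0)[h1 [_ [k kk]]] /(stripE _ _ a0 b0)[h2 [_ [l ll]]].
have := far (l - k); rewrite rmorphB/= => fk.
have [w0 w1 w2] := @cone_width_bound z.2 ltac:(lra).
have : `|x - x' + (l%:~R - k%:~R)| <= z.2 by rewrite ler_norml; lra.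
lra.
Qed.

End Strips.

(** * The Gaussian random measure *)

Section RandomMeasure.
Context (R : realType) (d : measure_display) (T : measurableType d)
        (P : probability T R).
Notation RR := (measurableTypeR R).
Context (mu : set (RR * RR) -> T -> R) (hmu : gaussian_random_measure P mu).
Implicit Types (A B : set (RR * RR)).

Lemma mu_mgf A (s c : R) : theta_finite A -> (theta A <= c%:E)%E ->
  (\int[P]_w (expR (s * mu A w))%:E <= (expR (s ^+ 2 * c / 2))%:E)%E.
Proof.
move=> fA tA.
have t0 := theta_ge0 A.
have fin : theta A \is a fin_num by rewrite ge0_fin_numE//; case: fA.
rewrite (gaussian_mgf _ (grm_measurable hmu fA) (grm_gaussian hmu fA)) ?fine_ge0//.
rewrite lee_fin ler_expR ler_pM2r// ler_wpM2l ?sqr_ge0//.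
by rewrite -lee_fin fineK.
Qed.

Lemma mu_tail A (s t c : R) : theta_finite A -> (theta A <= c%:E)%E ->
  (P [set w | t <= s * mu A w]%R <= (expR (s ^+ 2 * c / 2 - t))%:E)%E.
Proof.
move=> fA tA.
have t0 := theta_ge0 A.
have fin : theta A \is a fin_num by rewrite ge0_fin_numE//; case: fA.
have := gaussian_tail (fine_ge0 t0) (grm_measurable hmu fA) (grm_gaussian hmu fA) s t.
move=> /le_trans; apply.
rewrite lee_fin ler_expR lerD2r ler_pM2r// ler_wpM2l ?sqr_ge0//.
by rewrite -lee_fin fineK.
Qed.

(** The variance is 0, so the law is a Dirac mass at 0. *)
Lemma mu_set0 : {ae P, forall w, mu set0 w = 0}.
Proof.
have fA := @set0_finite R.
have m0 : measurable ([set 0] : set RR) by exact: measurable_set1.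
have := grm_gaussian hmu fA m0.
rewrite theta0 /= /centered_gaussian eqxx diracE mem_set//= => P1.
have mX : measurable (mu set0 @^-1` [set 0]).
  by rewrite -[X in measurable X]setTI; apply: (grm_measurable hmu fA).
exists (~` (mu set0 @^-1` [set 0])); split.
- exact: measurableC.
- by rewrite probability_setC// P1 -EFinB subrr.
- by move=> w /= h1 h2; apply: h1.
Qed.

(** Finite additivity is the countable one with empty sets added, on which the
random measure vanishes almost surely. *)
Lemma mu_setU A B : theta_finite A -> theta_finite B -> A `&` B = set0 ->
  theta_finite (A `|` B) -> {ae P, forall w, mu (A `|` B) w = mu A w + mu B w}.
Proof.
move=> fA fB AB fAB.
have fC n : theta_finite (bigcup2 A B n).
  by case: n => [//|[//|n]]; exact: set0_finite.
have tC : trivIset setT (bigcup2 A B).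
  by rewrite trivIset_bigcup2 in AB.
have UE : \bigcup_n bigcup2 A B n = A `|` B by rewrite bigcup2E.
have := grm_additive hmu fC tC; rewrite UE => /(_ fAB) h.
move: h mu_set0; apply: filterS2 => w cv m0.
have cv2 : series (fun n => mu (bigcup2 A B n) w) @ \oo --> mu A w + mu B w.
  apply: (@cvg_near_cst _ _ _ _ _); near=> n.
  have -> : n = (n - 2 + 2)%N by rewrite subnK//; near: n; exact: nbhs_infty_ge.
  rewrite addn2 /series/= !big_nat_recl//= big1 ?addr0//.
exact: (cvg_unique _ cv cv2).
Unshelve. all: by end_near. Qed.

(** The contribution of the common part of A and B cancels. *)
Lemma mu_sub A B : theta_finite A -> theta_finite B ->
  {ae P, forall w, mu A w - mu B w = mu (A `\` B) w - mu (B `\` A) w}.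
Proof.
move=> fA fB.
have mA : measurable A by case: fA.
have mB : measurable B by case: fB.
have fI : theta_finite (A `&` B).
  by apply: sub_theta_finite fA; [exact: measurableI|exact: subIsetl].
have fD : theta_finite (A `\` B).
  by apply: sub_theta_finite fA; [exact: measurableD|exact: subDsetl].
have fD' : theta_finite (B `\` A).
  by apply: sub_theta_finite fB; [exact: measurableD|exact: subDsetl].
have e1 : (A `&` B) `|` (A `\` B) = A by rewrite setUIDK.
have e2 : (A `&` B) `|` (B `\` A) = B by rewrite setIC setUIDK.
have h1 := @mu_setU (A `&` B) (A `\` B) fI fD _; rewrite e1 in h1.
have h2 := @mu_setU (A `&` B) (B `\` A) fI fD' _; rewrite e2 in h2.
have d1 : A `&` B `&` (A `\` B) = set0.
  by apply/seteqP; split => z // -[[_ h] [_ h']].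
have d2 : A `&` B `&` (B `\` A) = set0.
  by apply/seteqP; split => z // -[[h _] [_ h']].
move: (h1 d1 fA) (h2 d2 fB); apply: filterS2 => w -> ->; lra.
Qed.

Lemma mu_cone_split (b : nat -> R) (m : nat) (x : R) : 0 <= x < 1 ->
  (forall j, 0 < b j) -> (forall j, b j.+1 < b j) ->
  {ae P, forall w, mu (cone (b m) x) w =
     mu (cone (b 0%N) x) w + \sum_(j < m) mu (strip (b j.+1) (b j) x) w}.
Proof.
move=> x01 b0 bS; elim: m => [|m IH].
  by apply: aeW => w; rewrite big_ord0 addr0.
have sub : (cone (b m) x : set (RR * RR)) `<=` cone (b m.+1) x.
  by move=> z [h1 h2 h3]; split => //; apply: le_trans h2; exact: ltW.
have := @mu_setU (cone (b m) x) (strip (b m.+1) (b m) x)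
  (cone_finite x01 (b0 _)) (strip_finite _ x01 (b0 _)).
rewrite {2 3}/strip setDIK setDUK// => /(_ erefl (cone_finite x01 (b0 _))) h.
by move: IH h; apply: filterS2 => w e1 ->; rewrite e1 big_ord_recr/= addrA.
Qed.

End RandomMeasure.

(** * Counting sites in a window of the circle *)

Lemma card_spread (N K : nat) (A : {set 'I_N}) :
  (forall x y, x \in A -> y \in A -> (x <= y)%N -> (y - x <= K)%N) ->
  (#|A| <= K.+1)%N.
Proof.
move=> spr; have [->|[x0 x0A]] := set_0Vmem A; first by rewrite cards0.
case: (@arg_minnP _ x0 (mem A) (fun x => nat_of_ord x) x0A) => m0 m0A m0min.
pose f (x : 'I_N) : 'I_K.+1 := inord (x - m0)%N.
rewrite -(@card_in_imset _ _ f).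
  by rewrite -[leqRHS]card_ord max_card.
move=> x y xA yA; move: (m0min x xA) (m0min y yA) => mx my.
have hx := spr _ _ m0A xA mx; have hy := spr _ _ m0A yA my.
move=> /(congr1 (@nat_of_ord _)); rewrite /f !inordK ?ltnS// => e.
by apply/val_inj => /=; lia.
Qed.

Section Count.
Context (R : realType).

(** The window has length 2L, so that its integer points spread over at most 2L. *)
Lemma card_window (N : nat) (c L : R) : 1 <= L ->
  #|[set i : 'I_N | (`|c - i%:R| < L)%R]%SET|%:R <= 3 * L.
Proof.
move=> L1.
have K0 : 0 <= 2 * L by lra.
have /andP[K1 K2] := truncn_itv K0.
set K := Num.truncn _ in K1 K2.
have : (#|[set i : 'I_N | (`|c - i%:R| < L)%R]%SET| <= K.+1)%N.
  apply: card_spread => x y; rewrite !inE => hx hy xy.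
  have : (y%:R - x%:R : R) < K.+1%:R.
    by move: hx hy; rewrite !ltr_norml => /andP[? ?] /andP[? ?]; lra.
  by rewrite -natrB// ltr_nat ltnS.
rewrite -(ler_nat R) => /le_trans; apply.
rewrite -natr1; lra.
Qed.

(** On the circle only the translates by -N, 0 and N can come close to i, each
contributing one window. *)
Lemma card_circle_window (N : nat) (i : 'I_N) (L : R) : 1 <= L -> L <= N%:R ->
  #|[set j : 'I_N | `[< exists k : int, (`|i%:R - j%:R + k%:~R * N%:R| < L)%R >]]%SET|%:R
    <= 9 * L.
Proof.
move=> L1 LN.
pose W (k : R) := [set j : 'I_N | `|(i%:R + k * N%:R) - j%:R| < L]%SET.
have sub : [set j : 'I_N | `[< exists k : int, (`|i%:R - j%:R + k%:~R * N%:R| < L)%R >]]%SET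
    \subset (W 0%R :|: W 1%R) :|: W (-1)%R.
  apply/fintype.subsetP => j; rewrite inE => /asboolP[k hk]; rewrite !inE.
  have iN : (i%:R : R) < N%:R by rewrite ltr_nat.
  have jN : (j%:R : R) < N%:R by rewrite ltr_nat.
  have i0 : 0 <= (i%:R : R) by [].
  have j0 : 0 <= (j%:R : R) by [].
  have kb : - 2 < (k%:~R : R) < 2.
    move: hk; rewrite ltr_norml => /andP[h1 h2].
    have N0 : 0 < N%:R :> R by lra.
    apply/andP; split.
      rewrite -(ltr_pM2r N0); lra.
    rewrite -(ltr_pM2r N0); lra.
  have [k0|k0|k0] := small_int kb; move: hk; rewrite k0 => hk.
  - by apply/orP; left; apply/orP; left; move: hk; rewrite mulr0z addrAC.
  - by apply/orP; left; apply/orP; right; move: hk; rewrite addrAC.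
  - by apply/orP; right; move: hk; rewrite mulrN1z addrAC.
apply: (@le_trans _ _ (#|W 0%R| + #|W 1%R| + #|W (-1)%R|)%N%:R).
  rewrite ler_nat; apply: (leq_trans (subset_leq_card sub)).
  apply: (leq_trans (leq_card_setU _ _)); rewrite leq_add2r.
  exact: leq_card_setU.
rewrite !natrD.
have h k : #|W k|%:R <= 3 * L by exact: card_window.
have := h 0; have := h 1; have := h (-1); lra.
Qed.

End Count.

(** * Second moment of the number of good sites *)

Section Independence.
Context (R : realType) (d : measure_display) (T : measurableType d)
        (P : probability T R).
Notation RR := (measurableTypeR R).
Context (mu : set (RR * RR) -> T -> R) (hmu : gaussian_random_measure P mu).

Definition gaussian_exceedance (v h : R) : R := fine (centered_gaussian v (`[h, +oo[%classic : set RR)).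

Lemma measurable_ge_mu (A : set (RR * RR)) (h : R) : theta_finite A ->
  measurable [set w | h <= mu A w].
Proof.
move=> fA; apply: (@measurable_le_set R _ _ (cst h)) => //.
exact: (grm_measurable hmu fA).
Qed.

Lemma prob_ge_mu (A : set (RR * RR)) (v h : R) : theta_finite A ->
  theta A = v%:E -> P [set w | h <= mu A w] = (gaussian_exceedance v h)%:E.
Proof.
move=> fA tA.
have mB : measurable (`[h, +oo[%classic : set RR) by exact: measurable_itv.
have := grm_gaussian hmu fA mB.
rewrite tA /= /gaussian_exceedance => <-.
rewrite fineK; last first.
  apply: fin_num_measure.
  have -> : mu A @^-1` `[h, +oo[ = [set w | h <= mu A w].
    by apply/seteqP; split => w /=; rewrite in_itv/= andbT.
  exact: measurable_ge_mu.
by congr (P _); apply/seteqP; split => w /=; rewrite in_itv/= andbT.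
Qed.

(** Independence is assumed for infinite disjoint families, so the n given sets are
completed with empty sets. *)
Lemma prob_strips (A : nat -> set (RR * RR)) (n : nat) (v h : R) :
  (forall k, (k < n)%N -> theta_finite (A k)) ->
  (forall k, (k < n)%N -> theta (A k) = v%:E) ->
  (forall k l, (k < n)%N -> (l < n)%N -> k != l -> A k `&` A l = set0) ->
  P [set w | forall k, (k < n)%N -> h <= mu (A k) w] = (gaussian_exceedance v h ^+ n)%:E.
Proof.
move=> fA tA dA.
pose A' k := if (k < n)%N then A k else set0.
have fA' k : theta_finite (A' k).
  by rewrite /A'; case: ifP => kn; [exact: fA|exact: set0_finite].
have tA' : trivIset setT A'.
  apply/trivIsetP => k l _ _ kl; rewrite /A'.
  by case: ifP => kn; case: ifP => ln; rewrite ?set0I ?setI0//; exact: dA.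
have := grm_independent hmu fA' tA' (s := iota 0 n)
  (B := fun=> `[h, +oo[%classic) (iota_uniq 0 n) (fun=> measurable_itv _).
have -> : \bigcap_(k in [set` iota 0 n]) (mu (A' k) @^-1` `[h, +oo[) =
    [set w | forall k, (k < n)%N -> h <= mu (A k) w].
  apply/seteqP; split => w hw k /=.
    move=> kn; have := hw k; rewrite /= mem_iota /= add0n => /(_ kn).
    by rewrite /A' kn in_itv/= andbT.
  rewrite mem_iota /= add0n => kn.
  by rewrite /A' kn in_itv/= andbT; exact: hw.
move=> ->.
rewrite (eq_big_seq (fun _ : nat => (gaussian_exceedance v h)%:E)); last first.
  move=> k; rewrite mem_iota /= add0n => kn.
  rewrite -(prob_ge_mu h (fA k kn) (tA k kn)) /A' kn.
  by congr (P _); apply/seteqP; split => w /=; rewrite in_itv/= andbT.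
rewrite prodEFin; congr EFin.
by rewrite big_const_seq count_predT size_iota; elim: n {fA tA dA A' fA' tA'} => //= n ->; rewrite exprS.
Qed.

End Independence.

Section Pairs.
Context (R : realType) (d : measure_display) (T : measurableType d)
        (P : probability T R).
Notation RR := (measurableTypeR R).
Context (mu : set (RR * RR) -> T -> R) (hmu : gaussian_random_measure P mu).
Context (N m : nat) (v h : R).

(** The heights are in geometric progression, so that by [theta_block] all layers
have the same measure v; when N = exp((m + 1) v), the last one is 1/N. *)
Definition level (j : nat) : R := expR (- (j.+1%:R * v)).

Definition site (i : 'I_N) : R := i%:R / N%:R.

Definition block (j : nat) (i : 'I_N) : set (RR * RR) :=
  strip (level j.+1) (level j) (site i).

Definition good (i : 'I_N) : set T :=
  [set w | forall j, (j < m)%N -> h <= mu (block j i) w].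

(** At scale r the layers r, r + 1, ... above i and i' may intersect only if this
holds.  The circular distance is multiplied by N, which makes it a distance
between integers. *)
Definition near_at (r : nat) (i i' : 'I_N) : bool :=
  `[< exists k : int, `|i%:R - i'%:R + k%:~R * N%:R| < N%:R * level r >].

Hypothesis v0 : 0 < v.
Hypothesis Nv : N%:R = expR (m.+1%:R * v).
Hypothesis b2 : level 0 <= 2^-1.

Let p := gaussian_exceedance v h.

Lemma level_gt0 j : 0 < level j. Proof. exact: expR_gt0. Qed.

Lemma level_lt j k : (j < k)%N -> level k < level j.
Proof. by move=> jk; rewrite ltr_expR ltrN2 ltr_pM2r// ltr_nat. Qed.

Lemma level_le j k : (j <= k)%N -> level k <= level j.
Proof. by move=> jk; rewrite ler_expR lerN2 ler_pM2r// ler_nat. Qed.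

Let N0 : 0 < N%:R :> R. Proof. by rewrite Nv expR_gt0. Qed.

Lemma site_itv i : 0 <= site i < 1.
Proof.
have N1 : (0 < N)%N by apply: leq_trans (ltn_ord i).
by rewrite /site divr_ge0//= ltr_pdivrMr ?ltr0n// mul1r ltr_nat.
Qed.

Lemma theta_block j i : theta (block j i) = v%:E.
Proof.
rewrite /block theta_strip ?site_itv ?level_gt0//.
- by congr EFin; rewrite !expRK -natr1; ring.
- exact: level_lt.
- by apply: le_trans b2; exact: level_le.
Qed.

Lemma block_finite j i : theta_finite (block j i).
Proof. by apply: strip_finite; [exact: site_itv|exact: level_gt0]. Qed.

Lemma block_level j k i i' : (j < k)%N -> block j i `&` block k i' = set0.
Proof.
move=> jk; rewrite setIC; apply: strip_disjoint_level; rewrite ?level_gt0//.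
exact: level_le.
Qed.

Lemma block_far j r i i' : (r <= j)%N -> ~~ near_at r i i' ->
  block j i `&` block j i' = set0.
Proof.
move=> rj nr; apply: (@strip_disjoint_far _ _ _ _ _ (level r)).
- exact: level_gt0.
- exact: level_gt0.
- exact: level_le.
- exact: site_itv.
- exact: site_itv.
- move=> k; rewrite leNgt; apply/negP => hk; move/negP: nr; apply.
  apply/asboolP; exists k.
  have -> : i%:R - i'%:R + k%:~R * N%:R = N%:R * (site i - site i' + k%:~R) :> R.
    by rewrite /site; field; rewrite gt_eqF.
  by rewrite normrM gtr0_norm// ltr_pM2l.
Qed.

Lemma measurable_good i : measurable (good i).
Proof.
have -> : good i = \bigcap_(j in `I_m) [set w | h <= mu (block j i) w].
  by apply/seteqP; split => w hw j jm; exact: hw.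
apply: bigcap_measurableType => j _; apply: (measurable_ge_mu hmu); exact: block_finite.
Qed.

Lemma prob_good i : P (good i) = (p ^+ m)%:E.
Proof.
apply: (@prob_strips _ _ _ _ _ hmu (fun j => block j i)).
- by move=> k _; exact: block_finite.
- by move=> k _; exact: theta_block.
- move=> k l _ _; rewrite neq_ltn => /orP[kl|kl]; first exact: block_level.
  by rewrite setIC; exact: block_level.
Qed.

(** The events kept are all m constraints at i and those of the layers r, ..., m - 1
at i': these concern 2 m - r pairwise disjoint sets. *)
Lemma prob_good_pair r i i' : (r <= m)%N -> (r == m) || ~~ near_at r i i' ->
  (P (good i `&` good i') <= (p ^+ (2 * m - r))%:E)%E.
Proof.
move=> rm far.
(* The layers of i are numbered from 0 to m - 1, the layers r, ..., m - 1 of i'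
follow them. *)
pose A k := if (k < m)%N then block k i else block (k - m + r) i'.
pose n := (2 * m - r)%N.
have fA k : theta_finite (A k) by rewrite /A; case: ifP => _; exact: block_finite.
have tA k : theta (A k) = v%:E by rewrite /A; case: ifP => _; exact: theta_block.
have dlt k l : (k < n)%N -> (l < n)%N -> (k < l)%N -> A k `&` A l = set0.
  rewrite /A /n => kn ln kl; case: ifP => km; case: ifP => lm.
  - exact: block_level.
  - have [e|ne] := eqVneq k (l - m + r)%N.
      rewrite -e; apply: (@block_far _ r); first by lia.
      by case/orP: far => // /eqP rm'; lia.
    have [kl'|kl'] := ltnP k (l - m + r); first exact: block_level.
    by rewrite setIC; apply: block_level; rewrite ltn_neqAle eq_sym ne.
  - by lia.
  - by apply: block_level; lia.
rewrite -/n -(@prob_strips _ _ _ _ _ hmu A n v h) //; last first.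
  move=> k l kn ln; rewrite neq_ltn => /orP[kl|kl]; first exact: dlt.
  by rewrite setIC; exact: dlt.
apply: le_measure; rewrite ?inE.
- by apply: measurableI; exact: measurable_good.
- have -> : [set w | forall k, (k < n)%N -> h <= mu (A k) w] =
     \bigcap_(k in `I_n) [set w | h <= mu (A k) w].
    by apply/seteqP; split => w hw j jm; exact: hw.
  by apply: bigcap_measurableType => j _; apply: (measurable_ge_mu hmu).
- move=> w [g1 g2] k kn; rewrite /A; case: ifP => km; first exact: g1.
  by apply: g2; move: kn; rewrite /n; lia.
Qed.

Hypothesis p0 : 0 <= p.

(** This bounds the probability by a sum over scales instead of its term at the
actual scale of the pair, which makes the double sum over i and i' a sum of
window counts. *)
Lemma prob_good_pair_sum i i' :
  (P (good i `&` good i') <= (p ^+ (2 * m) +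
     \sum_(r < m) (near_at r i i')%:R * p ^+ (2 * m - r.+1))%:E)%E.
Proof.
have ex : exists r, (r == m) || ~~ near_at r i i' by exists m; rewrite eqxx.
(* r is the first scale at which the pair is not near, or m. *)
case: (ex_minnP ex) => r hr rmin.
have rm : (r <= m)%N by apply: rmin; rewrite eqxx.
apply: (le_trans (prob_good_pair rm hr)); rewrite lee_fin.
have t0 (k : 'I_m) : 0 <= (near_at k i i')%:R * p ^+ (2 * m - k.+1).
  by rewrite mulr_ge0// exprn_ge0.
case: r hr rmin rm => [|r] hr rmin rm.
  by rewrite subn0 lerDl sumr_ge0.
have nr : near_at r i i'.
  apply/negPn/negP => nn; have := rmin r; rewrite nn orbT => /(_ isT).
  by rewrite ltnn.
apply: ler_wpDl; first by rewrite exprn_ge0.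
rewrite (bigD1 (Ordinal rm))//= nr mul1r lerDl sumr_ge0//.
Qed.

Hypothesis m0 : (0 < m)%N.
Hypothesis pv : 1 <= p * expR v.

(** By [prob_good_pair_sum] the scale r contributes to the second moment, relatively
to the square of the mean, 9 N level(r) p^-(r+1) / N = 9 (p exp v)^-(r+1), which
is at most 9 / (p exp v) as soon as p exp v >= 1. *)
Lemma many_good :
  (P [set w | \sum_i \1_(good i) w <= N%:R * p ^+ m / 2]%R
    <= (36 * m%:R / (p * expR v))%:E)%E.
Proof.
have pgt0 : 0 < p.
  by rewrite lt_neqAle p0 andbT eq_sym; apply: contraTneq pv => ->; rewrite mul0r ler10.
have pvgt0 : 0 < p * expR v by rewrite mulr_gt0 ?expR_gt0.
have -> : 36 * m%:R / (p * expR v) = 4 * (9 * m%:R / (p * expR v)) :> R by ring.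
apply: (second_moment (G := good)).
- exact: measurable_good.
- by rewrite mulr_gt0// exprn_gt0.
- under eq_bigr do rewrite prob_good.
  by rewrite sumEFin sumr_const card_ord mulr_natl.
apply: (@le_trans _ _ (\sum_(i < N) \sum_(i' < N) (p ^+ (2 * m) +
     \sum_(r < m) (near_at r i i')%:R * p ^+ (2 * m - r.+1))%:E)%E).
  apply: lee_sum => i _; apply: lee_sum => i' _; exact: prob_good_pair_sum.
under eq_bigr do rewrite sumEFin.
rewrite sumEFin lee_fin.
under eq_bigr do rewrite big_split/= exchange_big/= sumr_const card_ord.
rewrite big_split/= sumr_const card_ord.
have cnt (r : 'I_m) i :
   \sum_(i' < N) (near_at r i i')%:R * p ^+ (2 * m - r.+1) <=
   9 * (N%:R * level r) * p ^+ (2 * m - r.+1).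
  rewrite -mulr_suml ler_wpM2r ?exprn_ge0//.
  have L1 : 1 <= N%:R * level r.
    rewrite Nv /level -expRD -[leLHS]expR0 ler_expR -mulNr -mulrDl mulr_ge0 ?ltW//.
    by rewrite subr_gt0 ltr_nat ltnS ltn_ord.
  have LN : N%:R * level r <= N%:R.
    rewrite ger_pMr// -[leRHS]expR0 ler_expR oppr_le0 mulr_ge0// ltW//.
  apply: le_trans (card_circle_window i L1 LN).
  rewrite -sum1_card natr_sum [leRHS]big_mkcond/=.
  apply: ler_sum => i' _; rewrite inE /near_at.
  by case: (`[< _ >]).
apply: (@le_trans _ _ (p ^+ (2 * m) *+ N *+ N +
    \sum_(i < N) \sum_(r < m) 9 * (N%:R * level r) * p ^+ (2 * m - r.+1))).
  by rewrite lerD2l; apply: ler_sum => i _; apply: ler_sum => r _; exact: cnt.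
rewrite sumr_const card_ord -[X in _ + X]mulr_natr.
have -> : p ^+ (2 * m) *+ N *+ N = p ^+ (2 * m) * N%:R * N%:R.
  by rewrite !mulr_natr.
have termE (r : 'I_m) : 9 * (N%:R * level r) * p ^+ (2 * m - r.+1) <=
   9 * N%:R * p ^+ (2 * m) / (p * expR v).
  have le1 : (p * expR v)^-1 ^+ r.+1 <= (p * expR v)^-1.
    have i1 : (p * expR v)^-1 <= 1 by rewrite invf_le1.
    have i0 : 0 <= (p * expR v)^-1 by rewrite invr_ge0 ltW.
    by rewrite exprS ger_pMr ?invr_gt0// exprn_ile1.
  have -> : level r = expR v ^- r.+1 by rewrite /level expRN -expRM_natl.
  have -> : p ^+ (2 * m - r.+1) = p ^+ (2 * m) * p ^- r.+1.
    have rm := ltn_ord r.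
    have -> : p ^+ (2 * m) = p ^+ (2 * m - r.+1) * p ^+ r.+1.
      by rewrite -exprD subnK//; lia.
    by rewrite mulfK// expf_neq0// gt_eqF.
  have -> : 9 * (N%:R * expR v ^- r.+1) * (p ^+ (2 * m) * p ^- r.+1) =
     9 * N%:R * p ^+ (2 * m) * (p * expR v)^-1 ^+ r.+1.
    by rewrite exprVn exprMn invfM; ring.
  by apply: ler_wpM2l => //; rewrite !mulr_ge0// exprn_ge0.
have : \sum_(r < m) 9 * (N%:R * level r) * p ^+ (2 * m - r.+1) <=
   (9 * N%:R * p ^+ (2 * m) / (p * expR v)) * m%:R.
  apply: (le_trans (ler_sum _ (fun r _ => termE r))).
  by rewrite sumr_const card_ord [leRHS]mulr_natr.
move=> hs; apply: (le_trans (lerD (lexx _) (ler_wpM2r (ltW N0) hs))).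
rewrite le_eqVlt; apply/orP; left; apply/eqP.
rewrite mul2n -addnn exprD; ring.
Qed.

End Pairs.

(** * Polynomially small probabilities *)

(** The quantity 1 - lam^2/2 + beta lam is the exponential rate of the contribution
to Z(beta) of the sites where the field is close to lam ln N.  Its maximum over
lam <= sqrt 2 is at lam = beta below the critical value, and at the excluded
boundary point sqrt 2 above it. *)
Lemma exists_slope (R : realType) (beta delta : R) : 0 < beta -> 0 < delta ->
  exists lam : R, [/\ 0 < lam, lam ^+ 2 < 2 &
    limit_free_energy beta - delta <= 1 - lam ^+ 2 / 2 + beta * lam].
Proof.
move=> b0 d0; rewrite /limit_free_energy /beta_c.
have s2 : Num.sqrt (2 : R) ^+ 2 = 2 by rewrite sqr_sqrtr.
have s0 : 0 < Num.sqrt (2 : R) by rewrite sqrtr_gt0.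
have s1 : 1 < Num.sqrt (2 : R).
  by rewrite -[ltLHS]sqrtr1 ltr_sqrt// ltr1n.
case: ltP => hb.
  exists beta; split => //; last by lra.
  by rewrite -s2 ltrXn2r// ?nnegrE ltW.
(* Above the critical value the maximum would be at sqrt 2; moving by e to the left
costs at most beta e, and e <= 1 keeps lam positive. *)
pose e := Num.min (delta / beta) 1.
have e0 : 0 < e by rewrite lt_min divr_gt0//=.
have e1 : e <= 1 by rewrite ge_min lexx orbT.
have eb : beta * e <= delta.
  have : e <= delta / beta by rewrite ge_min lexx.
  by rewrite ler_pdivlMr// mulrC.
exists (Num.sqrt 2 - e); split; [lra|nra|nra].
Qed.

Section TailAsymptotic.
Context (R : realType) (d : measure_display) (T : measurableType d)
        (P : probability T R).
Notation RR := (measurableTypeR R).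
Context (mu : set (RR * RR) -> T -> R) (hmu : gaussian_random_measure P mu).

(** The variance v is that of mu A, to which [gaussian_tail_ge] applies; the factor
1/sqrt(2 pi) and the lower order terms are absorbed into eta v for v large. *)
Lemma gaussian_exceedance_ge (lam eta : R) : 0 < lam -> 0 < eta ->
  exists v0 : R, forall (v : R) (A : set (RR * RR)), 0 < v -> v0 <= v ->
    theta_finite A -> theta A = v%:E ->
    expR (- (lam ^+ 2 / 2 + eta) * v) <= gaussian_exceedance v (lam * v).
Proof.
move=> l0 e0.
pose c1 : R := (Num.sqrt (pi *+ 2))^-1.
have c10 : 0 < c1 by rewrite invr_gt0 sqrtr_gt0 pmulrn_lgt0// pi_gt0.
(* The constant comes from absorbing lam sqrt v into eta v / 2 by the inequality
lam t <= eta t^2 / 2 + lam^2 / (2 eta) with t = sqrt v. *)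
exists (2 / eta * (- ln c1 + 2^-1 + lam ^+ 2 / (2 * eta))) => v A v0 vv fA tA.
have h0 : 0 <= lam * v by rewrite mulr_ge0// ltW.
have lawA (B : set RR) : measurable B -> P (mu A @^-1` B) = centered_gaussian v B.
  by move=> mB; rewrite (grm_gaussian hmu fA mB) tA.
have := gaussian_tail_ge (ltW v0) lawA v0 h0.
rewrite (prob_ge_mu hmu _ fA tA) lee_fin -/c1; apply: le_trans.
rewrite -[c1]lnK// -expRD ler_expR.
set t := Num.sqrt v.
have t2 : v = t ^+ 2 by rewrite sqr_sqrtr// ltW.
have t0 : 0 < t by rewrite sqrtr_gt0.
have e2 : - (lam * v + t) ^+ 2 / (v *+ 2) = - (lam ^+ 2 / 2 * v + lam * t + 2^-1).
  by rewrite t2; field; rewrite gt_eqF.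
rewrite e2.
have vv2 : - ln c1 + 2^-1 + lam ^+ 2 / (2 * eta) <= eta / 2 * v.
  move: vv; rewrite -(ler_pM2l (_ : 0 < eta / 2)) ?divr_gt0//.
  by rewrite !mulrA (_ : eta / 2 * 2 / eta = 1) ?mul1r//; field; rewrite gt_eqF.
have amgm : lam * t <= eta / 2 * v + lam ^+ 2 / (2 * eta).
  rewrite -subr_ge0.
  have -> : eta / 2 * v + lam ^+ 2 / (2 * eta) - lam * t = (eta * t - lam) ^+ 2 / (2 * eta).
    by rewrite t2; field; rewrite gt_eqF.
  by rewrite divr_ge0 ?sqr_ge0// mulr_ge0// ltW.
by lra.
Qed.

End TailAsymptotic.

Section PolySmall.
Context (R : realType) (d : measure_display) (T : measurableType d)
        (P : probability T R).

(** The event E N has probability O(N^-c) for some c > 0: enough to be summable along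
the powers of 2 and to tend to 0, and stable under unions. *)
Definition poly_small (E : nat -> set T) := exists C c : R, [/\ 0 <= C, 0 < c &
  \forall N \near \oo, measurable (E N) /\
    (P (E N) <= (C * expR (- c * ln N%:R))%:E)%E].

Lemma ln_nat_ge0 (N : nat) : 0 <= ln N%:R :> R.
Proof. by case: N => [|N]; [rewrite ln0|apply: ln_ge0; rewrite ler1n]. Qed.

Lemma poly_small_sub (E F : nat -> set T) : poly_small E ->
  (\forall N \near \oo, measurable (F N) /\ {ae P, forall w, F N w -> E N w}) ->
  poly_small F.
Proof.
move=> [C [c [C0 c0 hE]]] hF; exists C, c; split => //.
near=> N.
have [mE PE] : measurable (E N) /\ (P (E N) <= (C * expR (- c * ln N%:R))%:E)%E by near: N.
have [mF sF] : measurable (F N) /\ {ae P, forall w, F N w -> E N w} by near: N.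
by split => //; apply: le_trans PE; exact: ae_le_measure.
Unshelve. all: by end_near. Qed.

Lemma poly_smallU (E F : nat -> set T) : poly_small E -> poly_small F ->
  poly_small (fun N => E N `|` F N).
Proof.
move=> [C [c [C0 c0 hE]]] [D [e [D0 e0 hF]]].
exists (C + D), (Num.min c e); split; [exact: addr_ge0|by rewrite lt_min c0|].
near=> N.
have [mE PE] : measurable (E N) /\ (P (E N) <= (C * expR (- c * ln N%:R))%:E)%E by near: N.
have [mF PF] : measurable (F N) /\ (P (F N) <= (D * expR (- e * ln N%:R))%:E)%E by near: N.
split; first exact: measurableU.
apply: (le_trans (measureU2 P mE mF)); apply: (le_trans (leeD PE PF)).
rewrite -EFinD lee_fin mulrDl.
have L0 := ln_nat_ge0 N.
apply: lerD; rewrite ler_wpM2l// ler_expR !mulNr lerN2 ler_wpM2r// ge_min lexx ?orbT//.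
Unshelve. all: by end_near. Qed.

Lemma ln_nat_large (K : R) : \forall N \near \oo, K <= ln N%:R :> R.
Proof.
near=> N.
rewrite -[K]expRK ler_ln ?posrE ?expR_gt0//; last first.
  by rewrite ltr0n; near: N; exact: nbhs_infty_gt.
by near: N; exact: nbhs_infty_ger.
Unshelve. all: by end_near. Qed.

(** Borel-Cantelli: along N = 2^k the bound C N^-c is geometric. *)
Lemma poly_small_dyadic (E : nat -> set T) : poly_small E ->
  {ae P, forall w, \forall k \near \oo, ~ E (2 ^ k)%N w}.
Proof.
move=> [C [c [C0 c0 [N0 _ hE]]]].
pose F k := if (N0 <= 2 ^ k)%N then E (2 ^ k)%N else set0.
have ln2 : 0 < ln (2 : R) by apply: ln_gt0; rewrite ltr1n.
pose r := expR (- c * ln 2).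
have r0 : 0 < r by exact: expR_gt0.
have r1 : r < 1 by rewrite -[ltRHS]expR0 ltr_expR mulNr oppr_lt0 mulr_gt0.
have PF k : (P (F k) <= (C * r ^+ k)%:E)%E.
  rewrite /F; case: ifP => hk; last by rewrite measure0 lee_fin mulr_ge0// exprn_ge0// ltW.
  have [_ h] := hE _ hk; apply: (le_trans h); rewrite lee_fin ler_wpM2l//.
  rewrite natrX lnXn//.
  by rewrite (_ : - c * (ln 2 *+ k) = k%:R * (- c * ln 2)) ?expRM_natl// mulrnAr mulr_natl.
have mF k : measurable (F k).
  by rewrite /F; case: ifP => // hk; have [] := hE _ hk.
have := @borel_cantelli_ae _ _ _ P F (C / (1 - r)) mF.
have -> : (forall n, (\sum_(k < n) P (F k) <= (C / (1 - r))%:E)%E) <-> True; last first.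
  move=> /(_ Logic.I); apply: filterS => w [k0 _ hk].
  near=> k => Ek.
  have kk : (k0 <= k)%N by near: k; exact: nbhs_infty_ge.
  apply: (hk _ kk); rewrite /F ifT//.
  apply: (@leq_trans k); first by near: k; exact: nbhs_infty_ge.
  by apply: ltnW; exact: ltn_expl.
split => // _ n.
apply: (@le_trans _ _ (\sum_(k < n) (C * r ^+ k)%:E)%E).
  by apply: lee_sum => k _; exact: PF.
rewrite sumEFin lee_fin -mulr_sumr ler_wpM2l//.
rewrite -[leRHS]div1r ler_pdivlMr ?subr_gt0//.
have := subrX1 r n; have : 0 <= r ^+ n by rewrite exprn_ge0// ltW.
by move: (\sum_(k < n) _) => S; lra.
Unshelve. all: by end_near. Qed.

End PolySmall.

(** * The lower bound in probability *)

Section UnionBound.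
Context (R : realType) (d : measure_display) (T : measurableType d)
        (P : probability T R).

Lemma exists_ord_bigsetU (N : nat) (A : 'I_N -> set T) :
  [set w | exists i : 'I_N, A i w] =
  \big[setU/set0]_(i < N) [set w | exists j : 'I_N, j = i :> nat /\ A j w].
Proof.
rewrite -(@bigcup_mkord _ N (fun i => [set w | exists j : 'I_N, j = i :> nat /\ A j w])).
apply/seteqP; split => w.
  by move=> [i Ai]; exists i => //=; exists i.
by move=> [i _ [j [_ Aj]]]; exists j.
Qed.

Lemma measurable_exists_ord (N : nat) (A : 'I_N -> set T) :
  (forall i, measurable (A i)) -> measurable [set w | exists i : 'I_N, A i w].
Proof.
move=> mA; have -> : [set w | exists i : 'I_N, A i w] = \bigcup_(i in [set: 'I_N]) A i.
  by apply/seteqP; split => w; [move=> [i Ai]; exists i|move=> [i _ Ai]; exists i].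
by apply: fin_bigcup_measurable => // i _.
Qed.

Lemma union_bound (N : nat) (A : 'I_N -> set T) (r : R) :
  (forall i, measurable (A i)) -> (forall i, (P (A i) <= r%:E)%E) ->
  (P [set w | exists i : 'I_N, A i w] <= (N%:R * r)%:E)%E.
Proof.
move=> mA Ar.
have AE (i : 'I_N) : [set w | exists j : 'I_N, j = i :> nat /\ A j w] = A i.
  apply/seteqP; split => w; last by exists i.
  by move=> [j [ji Aj]]; rewrite -(_ : j = i)//; exact/val_inj.
rewrite exists_ord_bigsetU.
apply: (le_trans (@Boole_inequality _ _ _ P
    (fun n => [set w | exists j : 'I_N, j = n :> nat /\ A j w]) N _)).
  by move=> i iN; have := AE (Ordinal iN) => /= ->; exact: mA.
apply: (@le_trans _ _ (\sum_(i < N) r%:E)%E).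
  by apply: lee_sum => i _; rewrite AE; exact: Ar.
by rewrite sumEFin sumr_const card_ord mulr_natl.
Qed.

End UnionBound.

Section Lower.
Context (R : realType) (d : measure_display) (T : measurableType d)
        (P : probability T R).
Notation RR := (measurableTypeR R).
Context (mu : set (RR * RR) -> T -> R) (hmu : gaussian_random_measure P mu).

Lemma omega_finite (N : nat) (i : 'I_N) :
  theta_finite (cone (N%:R^-1 : R) (i%:R / N%:R) : set (RR * RR)).
Proof.
have N0 : (0 < N)%N by apply: leq_trans (ltn_ord i).
by apply: cone_finite; [exact: (site_itv R i)|rewrite invr_gt0 ltr0n].
Qed.

Definition partition_sum (beta : R) (N : nat) (w : T) : R :=
  \sum_(i < N) expR (beta * omega mu N%:R^-1 (i%:R / N%:R) w).

Lemma measurable_partition_sum beta N : measurable_fun setT (partition_sum beta N).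
Proof.
apply: measurable_sum => i.
apply: (measurableT_comp (@measurable_expR R)).
apply: (measurableT_comp (@mulrl_measurable R setT beta)).
by apply: (grm_measurable hmu); exact: omega_finite.
Qed.

Lemma partition_sum_gt0 beta N w : (0 < N)%N -> 0 < partition_sum beta N w.
Proof.
case: N => // N _; rewrite /partition_sum big_ord_recl ltr_pwDl ?expR_gt0//.
by apply: sumr_ge0 => i _; exact: expR_ge0.
Qed.

Lemma measurable_free_energy beta N : measurable_fun setT (free_energy mu beta N).
Proof.
apply: (measurableT_comp (@mulrl_measurable R setT (ln N%:R)^-1)).
apply: (measurableT_comp (@measurable_ln R)).
exact: measurable_partition_sum.
Qed.

Section Blocks.
Variables (m : nat).
Hypothesis m0 : (0 < m)%N.

Definition depth (N : nat) : R := ln N%:R / m.+1%:R.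

Lemma depthE N : m.+1%:R * depth N = ln N%:R.
Proof. by rewrite /depth mulrC divfK// pnatr_eq0. Qed.

Lemma depth_large (K : R) : \forall N \near \oo, K <= depth N.
Proof.
near=> N; rewrite /depth ler_pdivlMr ?ltr0n//.
by near: N; exact: ln_nat_large.
Unshelve. all: by end_near. Qed.

Lemma level0_le (v : R) : ln 2 <= v -> level v 0 <= 2^-1.
Proof.
move=> h; rewrite /level mul1r -[2^-1]lnK ?posrE ?invr_gt0//.
by rewrite lnV ?posrE// ler_expR lerN2.
Qed.

(** The bound 36 m / (p exp v) of [many_good] is at most
36 m exp(-(1 - lam^2/2 - eta) v), a negative power of N. *)
Lemma few_good_small (lam eta : R) : 0 < lam -> 0 < eta ->
  lam ^+ 2 / 2 + eta < 1 ->
  poly_small P (fun N => [set w |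
    \sum_(i < N) \1_(good mu m (depth N) (lam * depth N) i) w <=
    N%:R * expR (- (lam ^+ 2 / 2 + eta) * depth N) ^+ m / 2]%R).
Proof.
move=> l0 e0 c0.
have [v0 hv0] := gaussian_exceedance_ge hmu l0 e0.
exists (36 * m%:R), ((1 - (lam ^+ 2 / 2 + eta)) / m.+1%:R); split => //.
  by rewrite divr_gt0// subr_gt0.
near=> N.
have vpos : 0 < depth N by apply: (@lt_le_trans _ _ 1) => //; near: N; exact: depth_large.
have vv0 : v0 <= depth N by near: N; exact: depth_large.
have N0 : (0 < N)%N by near: N; exact: nbhs_infty_gt.
have b2 : level (depth N) 0 <= 2^-1 by apply: level0_le; near: N; exact: depth_large.
set v := depth N in vpos vv0 b2 *; set q := expR _.
have Nv : N%:R = expR (m.+1%:R * v) by rewrite /v depthE lnK// posrE ltr0n.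
have qp : q <= gaussian_exceedance v (lam * v).
  pose i := Ordinal N0.
  apply: (hv0 _ (block v 0 i)) => //.
  - exact: block_finite.
  - exact: theta_block.
have q0 : 0 < q by exact: expR_gt0.
have p0 : 0 <= gaussian_exceedance v (lam * v) by apply: le_trans qp; exact: ltW.
have mS (c : R) : measurable [set w | \sum_(i < N) \1_(good mu m v (lam * v) i) w <= c]%R.
  apply: (@measurable_le_set R _ _ _ (cst c)) => //.
  apply: measurable_sum => i; apply: measurable_indic.
  exact: (measurable_good hmu).
have qv : expR ((1 - (lam ^+ 2 / 2 + eta)) * v) <= gaussian_exceedance v (lam * v) * expR v.
  apply: (@le_trans _ _ (q * expR v)); last by rewrite ler_pM2r ?expR_gt0.
  by rewrite /q -expRD ler_expR; lra.
have qv1 : 1 <= gaussian_exceedance v (lam * v) * expR v.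
  apply: le_trans qv; rewrite -[leLHS]expR0 ler_expR mulr_ge0 ?ltW// subr_gt0//.
split; first exact: mS.
have := many_good hmu vpos Nv b2 p0 m0 qv1.
move=> h; apply: (@le_trans _ _ (P [set w |
    \sum_(i < N) \1_(good mu m v (lam * v) i) w <= N%:R * gaussian_exceedance v (lam * v) ^+ m / 2]%R)).
  apply: le_measure; rewrite ?inE; [exact: mS|exact: mS|].
  move=> w /= /le_trans; apply.
  rewrite ler_pM2r ?invr_gt0// ler_pM2l ?ltr0n//.
  by rewrite lerXn2r// nnegrE ltW.
apply: (le_trans h); rewrite lee_fin ler_wpM2l//.
rewrite -depthE -/v.
have -> : - ((1 - (lam ^+ 2 / 2 + eta)) / m.+1%:R) * (m.+1%:R * v) =
   - ((1 - (lam ^+ 2 / 2 + eta)) * v).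
  by rewrite mulNr mulrA divfK// pnatr_eq0.
by rewrite expRN lef_pV2// posrE ?expR_gt0// (lt_le_trans _ qv1).
Unshelve. all: by end_near. Qed.

(** The cone above height exp(-v) has measure at most 1 + v.  With the exponential
moment of order 3/e each of the N events has probability O(N^-2), provided that
m is large enough for the variance term 9 v / (2 e^2) not to exceed ln N. *)
Lemma coarse_small (e : R) : 0 < e -> 9 / (2 * e ^+ 2) <= m.+1%:R ->
  poly_small P (fun N => [set w | exists i : 'I_N,
    mu (cone (level (depth N) 0) (site R i)) w <= - (e * ln N%:R)]).
Proof.
move=> e0 hm.
exists (expR (9 / (2 * e ^+ 2))), 1; split => //.
near=> N.
have vpos : 0 < depth N by apply: (@lt_le_trans _ _ 1) => //; near: N; exact: depth_large.
have N0 : (0 < N)%N by near: N; exact: nbhs_infty_gt.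
have b2 : level (depth N) 0 <= 2^-1 by apply: level0_le; near: N; exact: depth_large.
set v := depth N in vpos b2 *.
have fA (i : 'I_N) : theta_finite (cone (level v 0) (site R i) : set (RR * RR)).
  by apply: cone_finite; [exact: (site_itv R i)|exact: expR_gt0].
have mA (i : 'I_N) : measurable [set w | mu (cone (level v 0) (site R i)) w <= - (e * ln N%:R)].
  by apply: (@measurable_le_set R _ _ _ (cst _)) => //; exact: (grm_measurable hmu).
split; first exact: measurable_exists_ord.
have tb (i : 'I_N) : (P [set w | mu (cone (level v 0) (site R i)) w <= - (e * ln N%:R)]%R <=
    (expR (9 / (2 * e ^+ 2) - 2 * ln N%:R))%:E)%E.
  have tA : (theta (cone (level v 0) (site R i) : set (RR * RR)) <= (1 + v)%:E)%E.
    apply: (le_trans (theta_cone_le (site_itv R i) (expR_gt0 _) b2)).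
    by rewrite expRK lee_fin; lra.
  have := mu_tail hmu (- (3 / e)) (3 * ln N%:R) (fA i) tA.
  rewrite (_ : [set w | (3 * ln N%:R <= - (3 / e) * mu (cone (level v 0) (site R i)) w)%R] =
     [set w | mu (cone (level v 0) (site R i)) w <= - (e * ln N%:R)]); last first.
    have E (X : R) : (3 * ln N%:R <= - (3 / e) * X) = (X <= - (e * ln N%:R)).
      rewrite (_ : - (3 / e) * X = 3 * - (X / e)); last by field; rewrite gt_eqF.
      by rewrite ler_pM2l// lerNr ler_pdivrMr// mulNr (mulrC e).
    by apply/seteqP; split => w /=; rewrite E.
  move=> /le_trans; apply; rewrite lee_fin ler_expR.
  have -> : (- (3 / e)) ^+ 2 * (1 + v) / 2 = 9 / (2 * e ^+ 2) + 9 / (2 * e ^+ 2) * v.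
    by field; rewrite gt_eqF.
  have : 9 / (2 * e ^+ 2) * v <= m.+1%:R * v by rewrite ler_pM2r.
  by rewrite depthE; lra.
apply: (le_trans (union_bound mA tb)).
rewrite lee_fin -{1}[N%:R]lnK ?posrE ?ltr0n// -!expRD ler_expR; lra.
Unshelve. all: by end_near. Qed.

End Blocks.

End Lower.

Section LowerTail.
Context (R : realType) (d : measure_display) (T : measurableType d)
        (P : probability T R).
Notation RR := (measurableTypeR R).
Context (mu : set (RR * RR) -> T -> R) (hmu : gaussian_random_measure P mu).

Lemma ae_omega_split (N m : nat) : (0 < N)%N ->
  let v : R := depth R m N in 0 < v ->
  {ae P, forall w, forall i : 'I_N, omega mu N%:R^-1 (site R i) w =
    mu (cone (level v 0) (site R i)) w + \sum_(j < m) mu (block v j i) w}.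
Proof.
move=> N0 v v0.
have NE : N%:R^-1 = level v m.
  by rewrite /level expRN depthE lnK// posrE ltr0n.
apply: filter_forall => i.
rewrite /omega NE.
apply: (mu_cone_split hmu (b := level v)).
- exact: site_itv.
- by move=> j; exact: level_gt0.
- by move=> j; exact: level_lt.
Qed.

(** At each good site the m layers contribute at least m lam v, and the cone above
them at least - e ln N. *)
Lemma partition_sum_ge (N m : nat) (beta lam eta e : R) (w : T) :
  (0 < N)%N -> 0 < beta -> let v : R := depth R m N in
  (forall i : 'I_N, omega mu N%:R^-1 (site R i) w =
    mu (cone (level v 0) (site R i)) w + \sum_(j < m) mu (block v j i) w) ->
  N%:R * expR (- (lam ^+ 2 / 2 + eta) * v) ^+ m / 2 <=
    \sum_(i < N) \1_(good mu m v (lam * v) i) w ->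
  (forall i : 'I_N, - (e * ln N%:R) <= mu (cone (level v 0) (site R i)) w) ->
  ln N%:R - m%:R * ((lam ^+ 2 / 2 + eta) * v) - ln 2
    + beta * (m%:R * (lam * v) - e * ln N%:R) <= ln (partition_sum mu beta N w).
Proof.
move=> N0 b0 v split_w cnt coarse.
set c := expR (beta * (m%:R * (lam * v) - e * ln N%:R)).
have h1 : (\sum_(i < N) \1_(good mu m v (lam * v) i) w) * c <= partition_sum mu beta N w.
  rewrite mulr_suml; apply: ler_sum => i _; rewrite indicE.
  case: (boolP (w \in _)) => [|_]; last by rewrite mul0r expR_ge0.
  rewrite inE mul1r => gi; rewrite ler_expR ler_pM2l// split_w addrC.
  apply: lerD; first exact: coarse.
  apply: (@le_trans _ _ (\sum_(j < m) lam * v)).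
    by rewrite sumr_const card_ord mulr_natl.
  by apply: ler_sum => j _; exact: gi.
have h2 : N%:R * expR (- (lam ^+ 2 / 2 + eta) * v) ^+ m / 2 * c <= partition_sum mu beta N w.
  by apply: le_trans h1; rewrite ler_pM2r// expR_gt0.
rewrite -ler_expR lnK ?posrE ?partition_sum_gt0//; apply: le_trans h2.
rewrite le_eqVlt; apply/orP; left; apply/eqP.
rewrite -expRM_natl -[X in X * expR _]lnK ?posrE ?ltr0n//.
have two : (2 : R)^-1 = expR (- ln 2) by rewrite expRN lnK ?posrE.
rewrite two /c -!expRD; congr expR; ring.
Qed.

(** The loss delta is shared between the choice of lam, the excess eta in the
exponent of the Gaussian tail, the coarse part e of the field, the missing layer
(of relative size 1/(m + 1)) and the factor 1/2 in the number of good sites. *)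
Lemma lower_tail (beta delta : R) : 0 < beta -> 0 < delta ->
  poly_small P (fun N => [set w |
    free_energy mu beta N w < limit_free_energy beta - delta]).
Proof.
move=> b0 d0.
have d4 : 0 < delta / 4 by lra.
have [lam [l0 l2 hlam]] := exists_slope b0 d4.
pose eta := Num.min (delta / 8) ((1 - lam ^+ 2 / 2) / 2).
have eta0 : 0 < eta by rewrite lt_min; apply/andP; split; lra.
have eta8 : eta <= delta / 8 by rewrite ge_min lexx.
have eta1 : lam ^+ 2 / 2 + eta < 1.
  have : eta <= (1 - lam ^+ 2 / 2) / 2 by rewrite ge_min lexx orbT.
  lra.
pose e := delta / (8 * beta).
have e0 : 0 < e by rewrite divr_gt0// mulr_gt0.
have be : beta * e = delta / 8 by rewrite /e; field; rewrite gt_eqF.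
(* The first bound is the one that [coarse_small] asks for, the second makes the
missing layer cost at most delta / 8. *)
pose K := Num.max (9 / (2 * e ^+ 2)) (8 * beta * lam / delta).
pose m := (Num.truncn K).+1.
have Km : K <= m.+1%:R.
  have K0 : 0 <= K.
    by rewrite le_max; apply/orP; left; rewrite divr_ge0// mulr_ge0// exprn_ge0// ltW.
  have /andP[_ h] := truncn_itv K0.
  by apply: (le_trans (ltW h)); rewrite ler_nat.
have m1 : 9 / (2 * e ^+ 2) <= m.+1%:R by apply: le_trans Km; rewrite le_max lexx.
have m2 : beta * lam <= delta / 8 * m.+1%:R.
  have : 8 * beta * lam / delta <= m.+1%:R by apply: le_trans Km; rewrite le_max lexx orbT.
  by rewrite ler_pdivrMr// => h; lra.
have m0 : (0 < m)%N by [].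
have ps := poly_smallU (few_good_small hmu m0 l0 eta0 eta1) (coarse_small hmu e0 m1).
apply: (poly_small_sub ps).
near=> N.
have N0 : (0 < N)%N by near: N; exact: nbhs_infty_gt.
have v0 : 0 < depth R m N by apply: (@lt_le_trans _ _ 1) => //; near: N; exact: depth_large.
have L0 : 8 * ln 2 / (3 * delta) <= ln N%:R by near: N; exact: ln_nat_large.
split.
  apply: (@measurable_lt_set R _ _ _ (cst _)) => //; exact: (measurable_free_energy hmu).
have := ae_omega_split N0 v0; apply: filterS => w hw.
have cnt : ~ (\sum_(i < N) \1_(good mu m (depth R m N) (lam * depth R m N) i) w <=
    N%:R * expR (- (lam ^+ 2 / 2 + eta) * depth R m N) ^+ m / 2) -> 
  ~ (exists i : 'I_N, mu (cone (level (depth R m N) 0) (site R i)) w <= - (e * ln N%:R)) ->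
  limit_free_energy beta - delta <= free_energy mu beta N w.
  move=> /negP; rewrite -ltNge => /ltW n1 n2.
  have n3 (i : 'I_N) : - (e * ln N%:R) <= mu (cone (level (depth R m N) 0) (site R i)) w.
    rewrite leNgt; apply/negP => h; apply: n2; exists i; exact: ltW.
  have := partition_sum_ge N0 b0 hw n1 n3.
  have Lgt0 : 0 < ln N%:R :> R.
    by rewrite -(@depthE R m N) mulr_gt0// ltr0n.
  rewrite /free_energy -/(partition_sum mu beta N w) ler_pdivlMl//.
  apply: le_trans.
  move: L0; rewrite ler_pdivrMr ?mulr_gt0// => L0.
  have DL := @depthE R m N.
  have mv : m%:R * depth R m N = ln N%:R - depth R m N by rewrite -DL -natr1; ring.
  have f1 : eta * (m%:R * depth R m N) <= delta / 8 * ln N%:R.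
    apply: ler_pM => //; first exact: ltW.
      by rewrite mulr_ge0// ltW.
    by rewrite mv; lra.
  have f2 : beta * lam * depth R m N <= delta / 8 * ln N%:R.
    by rewrite -DL mulrA ler_pM2r.
  have f3 := ler_wpM2r (ltW Lgt0) hlam.
  have e1 : m%:R * ((lam ^+ 2 / 2 + eta) * depth R m N) =
     lam ^+ 2 / 2 * (ln N%:R - depth R m N) + eta * (m%:R * depth R m N).
    by rewrite -mv; ring.
  have e2 : beta * (m%:R * (lam * depth R m N) - e * ln N%:R) =
    beta * lam * (ln N%:R - depth R m N) - delta / 8 * ln N%:R.
    by rewrite -mv -be; ring.
  have f4 : 0 <= lam ^+ 2 / 2 * depth R m N.
    by rewrite mulr_ge0 ?ltW// divr_gt0// exprn_gt0.
  by rewrite e1 e2; lra.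
move=> /= flt; apply: contrapT => /not_orP[n1 n2].
by have := cnt n1 n2; rewrite leNgt flt.
Unshelve. all: by end_near. Qed.

End LowerTail.

(** * The upper bound in probability *)

Section Upper.
Context (R : realType) (d : measure_display) (T : measurableType d)
        (P : probability T R).
Notation RR := (measurableTypeR R).
Context (mu : set (RR * RR) -> T -> R) (hmu : gaussian_random_measure P mu).
Context (beta : R) (hbeta : 0 < beta).

(** The inverse temperature at which the first moment is taken: above the critical
value the first moment of Z(beta) itself is too large. *)
Definition beta_cut : R := Num.min beta (beta_c R).

Lemma beta_cut_gt0 : 0 < beta_cut.
Proof. by rewrite lt_min hbeta/= sqrtr_gt0. Qed.

Lemma beta_cut_le : beta_cut <= beta.
Proof. by rewrite ge_min lexx. Qed.

Lemma limit_free_energyE :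
  limit_free_energy beta = beta / beta_cut * (1 + beta_cut ^+ 2 / 2).
Proof.
rewrite /limit_free_energy /beta_cut /beta_c.
have s0 : 0 < Num.sqrt (2 : R) by rewrite sqrtr_gt0.
case: ltP => h; first by rewrite divff ?mul1r// gt_eqF.
have s2 : Num.sqrt (2 : R) ^+ 2 = 2 by rewrite sqr_sqrtr.
move: s0 s2 {h}; move: (Num.sqrt 2) => s s0 s2.
rewrite s2 divff// (_ : 1 + 1 = s ^+ 2); last by rewrite s2.
by field; rewrite gt_eqF.
Qed.

(** For p = beta / beta_cut >= 1, the l^p norm of the vector of the exp(beta_cut X_i)
is at most its l^1 norm. *)
Lemma ln_partition_sum_le N w : (0 < N)%N ->
  ln (partition_sum mu beta N w) <=
    beta / beta_cut * ln (partition_sum mu beta_cut N w).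
Proof.
move=> N0; have b10 := beta_cut_gt0; set b1 := beta_cut in b10 *.
set Z := partition_sum mu b1 N w.
have Z0 : 0 < Z by exact: partition_sum_gt0.
have Xle (i : 'I_N) : b1 * omega mu N%:R^-1 (i%:R / N%:R) w <= ln Z.
  rewrite -ler_expR lnK// /Z /partition_sum (bigD1 i)//= lerDl.
  by apply: sumr_ge0 => j _; exact: expR_ge0.
rewrite -ler_expR lnK ?posrE ?partition_sum_gt0//.
have -> : expR (beta / b1 * ln Z) = Z * expR ((beta / b1 - 1) * ln Z).
  by rewrite -{2}[Z]lnK// -expRD; congr expR; ring.
rewrite {1}/Z /partition_sum mulr_suml; apply: ler_sum => i _.
rewrite -expRD ler_expR.
have -> : beta * omega mu N%:R^-1 (i%:R / N%:R) w =
   b1 * omega mu N%:R^-1 (i%:R / N%:R) w +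
   (beta / b1 - 1) * (b1 * omega mu N%:R^-1 (i%:R / N%:R) w).
  by field; rewrite gt_eqF.
rewrite lerD2l ler_wpM2l//.
by rewrite subr_ge0 ler_pdivlMr// mul1r; exact: beta_cut_le.
Qed.

Lemma omega_theta (N : nat) (i : 'I_N) : (1 < N)%N ->
  (theta (cone (N%:R^-1 : R) (site R i) : set (RR * RR)) <= (1 + ln N%:R)%:E)%E.
Proof.
move=> N1.
have N0 : 0 < N%:R :> R by rewrite ltr0n ltnW.
have h : (N%:R^-1 : R) <= 2^-1 by rewrite lef_pV2 ?posrE// ler_nat.
apply: (le_trans (theta_cone_le (site_itv R i) _ h)); first by rewrite invr_gt0.
by rewrite lnV ?posrE// opprK.
Qed.

Lemma expectation_partition_sum (b : R) N : (1 < N)%N ->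
  (\int[P]_w (partition_sum mu b N w)%:E <=
    (expR ((1 + b ^+ 2 / 2) * ln N%:R + b ^+ 2 / 2))%:E)%E.
Proof.
move=> N1.
have N0 : 0 < N%:R :> R by rewrite ltr0n ltnW.
rewrite /partition_sum; under eq_integral do rewrite -sumEFin.
rewrite ge0_integral_sum//; last first.
  move=> i; apply/measurable_EFinP.
  apply: (measurableT_comp (@measurable_expR R)).
  apply: (measurableT_comp (@mulrl_measurable R setT b)).
  by apply: (grm_measurable hmu); exact: omega_finite.
apply: (@le_trans _ _ (\sum_(i < N) (expR (b ^+ 2 * (1 + ln N%:R) / 2))%:E)%E).
  apply: lee_sum => i _; apply: (mu_mgf hmu); first exact: omega_finite.
  exact: omega_theta.
rewrite sumEFin sumr_const card_ord lee_fin -[leLHS]mulr_natl -[X in X * _]lnK//.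
by rewrite -expRD ler_expR; lra.
Qed.

(** Markov's inequality for Z(beta_cut). *)
Lemma upper_tail (delta : R) : 0 < delta ->
  poly_small P (fun N => [set w |
    limit_free_energy beta + delta < free_energy mu beta N w]).
Proof.
move=> d0; have b10 := beta_cut_gt0.
pose d1 := delta * beta_cut / beta.
have d10 : 0 < d1 by rewrite divr_gt0// mulr_gt0.
exists (expR (beta_cut ^+ 2 / 2)), d1; split => //.
near=> N.
have N1 : (1 < N)%N by near: N; exact: nbhs_infty_gt.
have L0 : 1 <= ln N%:R :> R by near: N; exact: ln_nat_large.
set L := ln N%:R in L0 *.
have mE : measurable [set w | limit_free_energy beta + delta < free_energy mu beta N w].
  apply: (@measurable_lt_set R _ _ (cst _)) => //; exact: (measurable_free_energy hmu).
split => //.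
set a := 1 + beta_cut ^+ 2 / 2.
have sub : [set w | limit_free_energy beta + delta < free_energy mu beta N w] `<=`
    [set w | expR ((a + d1) * L) <= partition_sum mu beta_cut N w].
  move=> w /=; rewrite /free_energy -/(partition_sum mu beta N w) -/L.
  rewrite ltr_pdivlMl ?(lt_le_trans _ L0)// => h.
  have h2 := lt_le_trans h (ln_partition_sum_le w (ltnW N1)).
  have Z0 : 0 < partition_sum mu beta_cut N w by apply: partition_sum_gt0; exact: ltnW.
  rewrite -[leRHS]lnK// ler_expR.
  have bb : 0 < beta / beta_cut by rewrite divr_gt0.
  rewrite -(ler_pM2l bb); apply: le_trans (ltW h2).
  rewrite limit_free_energyE -/a /d1 le_eqVlt; apply/orP; left; apply/eqP.
  by field; rewrite !gt_eqF.
have mZ := measurable_partition_sum hmu beta_cut N.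
apply: (le_trans (le_measure P _ _ sub)); rewrite ?inE//.
  exact: (@measurable_le_set R _ _ (cst _)).
have Z0 w : 0 <= partition_sum mu beta_cut N w.
  by apply/ltW/partition_sum_gt0; exact: ltnW.
apply: (le_trans (markov_ge0 P mZ Z0 (expR_gt0 _))).
apply: (le_trans (lee_wpmul2l _ (expectation_partition_sum _ N1))).
  by rewrite lee_fin invr_ge0 expR_ge0.
rewrite -EFinM lee_fin -expRN -!expRD ler_expR -/L -/a.
rewrite le_eqVlt; apply/orP; left; apply/eqP; ring.
Unshelve. all: by end_near. Qed.

End Upper.

(** * Comparison of neighbouring scales *)

Section Rescale.
Variables (M N : nat).
Hypotheses (M0 : (0 < M)%N) (MN : (M <= N)%N).

Lemma rescale_proof (q : 'I_M) : (q * N %/ M < N)%N.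
Proof.
rewrite ltn_divLR// mulnC ltn_pmul2l//; exact: leq_trans M0 MN.
Qed.

(** Matches q/M with the last site of the lattice of step 1/N that is not after
it. *)
Definition rescale (q : 'I_M) : 'I_N := Ordinal (rescale_proof q).

(** Consecutive sites of the coarse lattice are at distance 1/M >= 1/N, so that they
do not have the same image. *)
Lemma rescale_lt (q q' : 'I_M) : (q < q')%N -> (rescale q < rescale q')%N.
Proof.
move=> qq; rewrite /=; apply: (@leq_trans ((q * N + M) %/ M)).
  by rewrite divnDr// divnn M0 addn1.
apply: leq_div2r; apply: (@leq_trans (q.+1 * N)).
  by rewrite mulSn addnC leq_add2r.
by rewrite leq_mul2r qq orbT.
Qed.

Lemma rescale_inj : injective rescale.
Proof.
move=> q q' e; apply: ord_inj.
by case: (ltngtP q q') => // /rescale_lt; rewrite e ltnn.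
Qed.

Lemma rescale_dist (R : realType) (q : 'I_M) :
  `|site R q - site R (rescale q)| <= N%:R^-1.
Proof.
have M1 : 0 < M%:R :> R by rewrite ltr0n.
have N1 : 0 < N%:R :> R by rewrite ltr0n (leq_trans M0).
rewrite /site /=.
have e := divn_eq (q * N) M.
have lt := ltn_pmod (q * N) M0.
have e' : q%:R * N%:R = (q * N %/ M)%:R * M%:R + (q * N %% M)%:R :> R.
  by rewrite -!natrM -natrD -e.
have -> : q%:R / M%:R - (q * N %/ M)%:R / N%:R = (q * N %% M)%:R / (M%:R * N%:R) :> R.
  have -> : (q * N %% M)%:R = q%:R * N%:R - (q * N %/ M)%:R * M%:R :> R by rewrite e'; ring.
  by field; rewrite !gt_eqF.
rewrite ger0_norm; last by rewrite divr_ge0// mulr_ge0.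
rewrite ler_pdivrMr ?mulr_gt0// mulrCA mulVf ?gt_eqF// mulr1 ler_nat.
exact: ltnW.
Qed.

End Rescale.

Section Compare.
Context (R : realType) (d : measure_display) (T : measurableType d)
        (P : probability T R).
Notation RR := (measurableTypeR R).
Context (mu : set (RR * RR) -> T -> R) (hmu : gaussian_random_measure P mu).

(** The bound c / u of [theta_cone_diff] with c = 2/N, which dominates twice the
distance of the centers and, as N <= 2 M, also the height 1/M. *)
Lemma site_diff_theta (M N : nat) (x x' : R) : (0 < M)%N -> (M <= N)%N -> (N <= 2 * M)%N ->
  (4 < N)%N -> 0 <= x < 1 -> 0 <= x' < 1 -> `|x - x'| <= N%:R^-1 ->
  (theta ((cone M%:R^-1 x : set (RR * RR)) `\` cone N%:R^-1 x') <= 2%:E)%E /\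
  (theta ((cone N%:R^-1 x' : set (RR * RR)) `\` cone M%:R^-1 x) <= 2%:E)%E.
Proof.
move=> M0 MN NM N4 x01 x01' xx.
have M1 : 0 < M%:R :> R by rewrite ltr0n.
have N1 : 0 < N%:R :> R by rewrite ltr0n (leq_trans M0).
have h4 : N%:R^-1 < 4^-1 :> R by rewrite ltf_pV2 ?posrE// ltr_nat.
have MV : 0 < M%:R^-1 :> R by rewrite invr_gt0.
have NV : 0 < N%:R^-1 :> R by rewrite invr_gt0.
have NM' : M%:R^-1 <= 2 * N%:R^-1 :> R.
  rewrite -(ler_pM2l N1) mulrCA divff ?gt_eqF// mulr1 ler_pdivrMr// -natrM ler_nat//.
have MN' : M%:R <= N%:R :> R by rewrite ler_nat.
split.
  apply: (le_trans (@theta_cone_diff _ M%:R^-1 N%:R^-1 x x' N%:R^-1 (2 * N%:R^-1)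
    x01 x01' MV NV xx h4 (lexx _) _)); first by lra.
  by rewrite lee_fin invrK -mulrA ger_pMr// mulrC ler_pdivrMr// mul1r.
rewrite distrC in xx.
apply: (le_trans (@theta_cone_diff _ N%:R^-1 M%:R^-1 x' x N%:R^-1 (2 * N%:R^-1)
    x01' x01 NV MV xx h4 (lexx _) NM')).
by rewrite lee_fin invrK -mulrA mulVf ?mulr1// gt_eqF.
Qed.

(** When this fails, the field at x on the scale M exceeds the field at x' on the
scale N by less than 2 t, by [mu_sub]. *)
Definition far_pair (M N : nat) (t x x' : R) : set T :=
  [set w | t <= mu ((cone M%:R^-1 x : set (RR * RR)) `\` cone N%:R^-1 x') w] `|`
  [set w | t <= - mu ((cone N%:R^-1 x' : set (RR * RR)) `\` cone M%:R^-1 x) w].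

Lemma far_pair_bound (M N : nat) (t s x x' : R) : (0 < M)%N -> (M <= N)%N -> (N <= 2 * M)%N ->
  (4 < N)%N -> 0 <= x < 1 -> 0 <= x' < 1 -> `|x - x'| <= N%:R^-1 -> 0 < s ->
  measurable (far_pair M N t x x') /\
  (P (far_pair M N t x x') <= (2 * expR (s ^+ 2 - s * t))%:E)%E.
Proof.
move=> M0 MN NM N4 x01 x01' xx s0.
have [t1 t2] := site_diff_theta M0 MN NM N4 x01 x01' xx.
have M1 : 0 < M%:R :> R by rewrite ltr0n.
have N1 : 0 < N%:R :> R by rewrite ltr0n (leq_trans M0).
have f1 : theta_finite ((cone M%:R^-1 x : set (RR * RR)) `\` cone N%:R^-1 x').
  apply: (sub_theta_finite _ (@subDsetl _ _ _)).
    by apply: measurableD; exact: measurable_cone.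
  by apply: cone_finite; rewrite // invr_gt0.
have f2 : theta_finite ((cone N%:R^-1 x' : set (RR * RR)) `\` cone M%:R^-1 x).
  apply: (sub_theta_finite _ (@subDsetl _ _ _)).
    by apply: measurableD; exact: measurable_cone.
  by apply: cone_finite; rewrite // invr_gt0.
have m1 : measurable [set w | t <= mu ((cone M%:R^-1 x : set (RR * RR)) `\` cone N%:R^-1 x') w].
  by apply: (@measurable_le_set R _ _ (cst _)) => //; exact: (grm_measurable hmu).
have m2 : measurable [set w | t <= - mu ((cone N%:R^-1 x' : set (RR * RR)) `\` cone M%:R^-1 x) w].
  apply: (@measurable_le_set R _ _ (cst _)) => //; apply: measurable_funN.
  exact: (grm_measurable hmu).
split; first exact: measurableU.
apply: (le_trans (measureU2 P m1 m2)).
have -> : 2 * expR (s ^+ 2 - s * t) = expR (s ^+ 2 - s * t) + expR (s ^+ 2 - s * t) by ring.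
rewrite EFinD; apply: leeD.
  have := mu_tail hmu s (s * t) f1 t1.
  rewrite (_ : s ^+ 2 * 2 / 2 = s ^+ 2); last by field.
  by apply: le_trans; rewrite le_eqVlt; apply/orP; left; apply/eqP;
    congr (P _); apply/seteqP; split => w /=; rewrite ler_pM2l.
have := mu_tail hmu (- s) (s * t) f2 t2.
rewrite (_ : (- s) ^+ 2 * 2 / 2 = s ^+ 2); last by field.
by apply: le_trans; rewrite le_eqVlt; apply/orP; left; apply/eqP;
    congr (P _); apply/seteqP; split => w /=; rewrite mulNr -mulrN ler_pM2l.
Qed.

Lemma partition_sum_compare (M N : nat) (beta t : R) (w : T) (M0 : (0 < M)%N) (MN : (M <= N)%N) :
  0 < beta ->
  (forall q : 'I_M, omega mu M%:R^-1 (site R q) w <=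
     omega mu N%:R^-1 (site R (rescale M0 MN q)) w + t) ->
  ln (partition_sum mu beta M w) <= ln (partition_sum mu beta N w) + beta * t.
Proof.
move=> b0 h.
have N0 : (0 < N)%N := leq_trans M0 MN.
rewrite -ler_expR expRD !lnK ?posrE ?partition_sum_gt0//.
apply: (@le_trans _ _ ((\sum_(q < M) expR (beta *
    omega mu N%:R^-1 (site R (rescale M0 MN q)) w)) * expR (beta * t))).
  rewrite mulr_suml; apply: ler_sum => q _.
  by rewrite -expRD ler_expR -mulrDr ler_pM2l//; exact: h.
rewrite ler_pM2r ?expR_gt0//.
rewrite /partition_sum.
rewrite -(big_imset (fun i : 'I_N => expR (beta * omega mu N%:R^-1 (site R i) w)))/=; last first.
  by move=> q q' _ _; exact: rescale_inj.
rewrite [leRHS](bigID (mem [set rescale M0 MN x | x in predT]%SET))/= lerDl.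
by apply: sumr_ge0 => i _; exact: expR_ge0.
Qed.

End Compare.

Section CompareAE.
Context (R : realType) (d : measure_display) (T : measurableType d)
        (P : probability T R).
Notation RR := (measurableTypeR R).
Context (mu : set (RR * RR) -> T -> R) (hmu : gaussian_random_measure P mu).

(** With the exponential moment of order 6/e, each of the at most n matched pairs is
bad with probability O(n^-3), so that the union bound is summable over all n. *)
Lemma compare_ae (M N : nat -> nat) (beta e : R) : 0 < beta -> 0 < e ->
  (forall n, (4 < n)%N -> [/\ (0 < M n)%N, (M n <= N n)%N, (N n <= 2 * M n)%N,
     (M n <= n)%N & (4 < N n)%N]) ->
  {ae P, forall w, \forall n \near \oo,
    ln (partition_sum mu beta (M n) w) <=
      ln (partition_sum mu beta (N n) w) + beta * (e * ln n%:R)}.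
Proof.
move=> b0 e0 hMN.
(* The site matched with q, written without the proofs that [rescale] takes, which
are available only for n > 4. *)
pose x' n (q : 'I_(M n)) : R := (q * N n %/ M n)%N%:R / (N n)%:R.
pose E n := [set w | exists q : 'I_(M n),
  far_pair mu (M n) (N n) (e * ln n%:R / 2) (site R q) (x' n q) w].
pose F n := if (4 < n)%N then E n else set0.
(* The factor 12 is 2 for the two sides of a pair times 6, from the inequality
(n + 1)(n + 2) <= 6 n^2, which makes the bounds telescope. *)
pose C : R := 12 * expR (36 / e ^+ 2).
have C0 : 0 <= C by rewrite mulr_ge0 ?expR_ge0.
have x'E n (M0 : (0 < M n)%N) (MN : (M n <= N n)%N) q : x' n q = site R (rescale M0 MN q) by [].
have hE n : (4 < n)%N -> forall q : 'I_(M n),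
    measurable (far_pair mu (M n) (N n) (e * ln n%:R / 2) (site R q) (x' n q)) /\
    (P (far_pair mu (M n) (N n) (e * ln n%:R / 2) (site R q) (x' n q)) <=
      (2 * expR ((6 / e) ^+ 2 - (6 / e) * (e * ln n%:R / 2)))%:E)%E.
  move=> n4 q; have [M0 MN NM Mn N4] := hMN n n4.
  apply: (far_pair_bound hmu) => //.
  - exact: site_itv.
  - by rewrite (x'E n M0 MN); exact: site_itv.
  - by rewrite (x'E n M0 MN); exact: rescale_dist.
  - by rewrite divr_gt0.
have mF n : measurable (F n).
  rewrite /F; case: ifP => n4 //; apply: measurable_exists_ord => q.
  by have [] := hE n n4 q.
have PF n : (P (F n) <= (C * (n.+1%:R^-1 - n.+2%:R^-1))%:E)%E.
  have nn : 0 <= n.+1%:R^-1 - n.+2%:R^-1 :> R.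
    by rewrite subr_ge0 lef_pV2 ?posrE ?ltr0n// ler_nat.
  rewrite /F; case: ifP => n4; last by rewrite measure0 lee_fin mulr_ge0.
  have [M0 MN NM Mn N4] := hMN n n4.
  have := @union_bound R _ T P _ _ (2 * expR ((6 / e) ^+ 2 - (6 / e) * (e * ln n%:R / 2)))
    (fun q => (hE n n4 q).1) (fun q => (hE n n4 q).2).
  move=> /le_trans; apply; rewrite lee_fin.
  have n0 : 0 < n%:R :> R by rewrite ltr0n; lia.
  have n1 : 1 <= n%:R :> R by rewrite ler1n; lia.
  have -> : (6 / e) ^+ 2 - (6 / e) * (e * ln n%:R / 2) = 36 / e ^+ 2 - 3%:R * ln n%:R.
    by field; rewrite gt_eqF.
  rewrite expRD expRN expRM_natl lnK ?posrE//.
  apply: (@le_trans _ _ (n%:R * (2 * (expR (36 / e ^+ 2) / n%:R ^+ 3)))).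
    rewrite ler_wpM2r ?ler_nat// mulr_ge0// divr_ge0 ?expR_ge0// exprn_ge0//.
  have -> : n%:R * (2 * (expR (36 / e ^+ 2) / n%:R ^+ 3)) =
     C * (6 * n%:R ^+ 2)^-1 :> R.
    by rewrite /C; field; rewrite gt_eqF.
  rewrite ler_wpM2l//.
  have -> : n.+1%:R^-1 - n.+2%:R^-1 = ((n%:R + 1) * (n%:R + 2))^-1 :> R.
    have -> : n.+1%:R = n%:R + 1 :> R by rewrite -natr1.
    have -> : n.+2%:R = n%:R + 2 :> R by rewrite -addn2 natrD.
    by field; apply/andP; split; rewrite gt_eqF//; lra.
  rewrite lef_pV2 ?posrE; [nra|by rewrite mulr_gt0// exprn_gt0|by rewrite mulr_gt0//; lra].
have sF n : (\sum_(k < n) P (F k) <= C%:E)%E.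
  apply: (@le_trans _ _ (C * (1 - n.+1%:R^-1))%:E); last first.
    by rewrite lee_fin ler_piMr// lerBlDr lerDl invr_ge0.
  elim: n => [|n IH]; first by rewrite big_ord0 lee_fin invr1 subrr mulr0.
  rewrite big_ord_recr/=; apply: (le_trans (leeD IH (PF n))).
  rewrite -EFinD lee_fin; move: n.+1%:R^-1 n.+2%:R^-1 => a b; lra.
have h1 := borel_cantelli_ae mF sF.
have h2 : {ae P, forall w, forall n, (4 < n)%N -> forall q : 'I_(M n),
   omega mu (M n)%:R^-1 (site R q) w - omega mu (N n)%:R^-1 (x' n q) w =
   mu ((cone (M n)%:R^-1 (site R q) : set (RR * RR)) `\` cone (N n)%:R^-1 (x' n q)) w -
   mu ((cone (N n)%:R^-1 (x' n q) : set (RR * RR)) `\` cone (M n)%:R^-1 (site R q)) w}.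
  apply: ae_foralln => n; case: (ltnP 4 n) => n4; last exact: aeW.
  have [M0 MN NM Mn N4] := hMN n n4.
  have : {ae P, forall w, forall q : 'I_(M n),
   omega mu (M n)%:R^-1 (site R q) w - omega mu (N n)%:R^-1 (x' n q) w =
   mu ((cone (M n)%:R^-1 (site R q) : set (RR * RR)) `\` cone (N n)%:R^-1 (x' n q)) w -
   mu ((cone (N n)%:R^-1 (x' n q) : set (RR * RR)) `\` cone (M n)%:R^-1 (site R q)) w}.
    apply: filter_forall => q; apply: (mu_sub hmu).
      exact: omega_finite.
    by rewrite (x'E n M0 MN); exact: omega_finite.
  by apply: filterS => w hw _.
move: h1 h2; apply: filterS2 => w [n0 _ hw] hs.
near=> n.
have n4 : (4 < n)%N by near: n; exact: nbhs_infty_gt.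
have nn0 : (n0 <= n)%N by near: n; exact: nbhs_infty_ge.
have [M0 MN NM Mn N4] := hMN n n4.
apply: (partition_sum_compare (M0 := M0) (MN := MN)) => // q.
rewrite -(x'E n M0 MN) -lerBlDl hs//.
have nE : ~ E n w by have := hw n nn0; rewrite /F n4.
have {}nE : ~ far_pair mu (M n) (N n) (e * ln n%:R / 2) (site R q) (x' n q) w.
  by move=> h; apply: nE; exists q.
have /not_orP[/= /negP + /negP] := nE; rewrite -!ltNge => l1 l2.
lra.
Unshelve. all: by end_near. Qed.

End CompareAE.

(** * Almost sure convergence *)

Section AlmostSure.
Context (R : realType) (d : measure_display) (T : measurableType d)
        (P : probability T R).
Notation RR := (measurableTypeR R).
Context (mu : set (RR * RR) -> T -> R) (hmu : gaussian_random_measure P mu).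
Context (beta : R) (hbeta : 0 < beta).

Let l := limit_free_energy beta.
Let lnZ N w := ln (partition_sum mu beta N w).

Lemma limit_free_energy_ge0 : 0 <= l.
Proof.
rewrite /l limit_free_energyE// mulr_ge0//.
  by rewrite divr_ge0// ltW// beta_cut_gt0.
by rewrite addr_ge0// divr_ge0// sqr_ge0.
Qed.

Lemma ln_dyadic (k : nat) : ln (2 ^ k)%:R = k%:R * ln 2 :> R.
Proof. by rewrite natrX lnXn// mulr_natl. Qed.

(** Replacing ln N by the logarithm of one of the two neighbouring powers of 2 changes
it by at most ln 2, which is negligible compared with ln N. *)
Lemma free_energy_dyadic (delta : R) (N : nat) (w : T) : (4 < N)%N -> 0 < delta ->
  let k := trunc_log 2 N in
  (l + delta) * ln 2 <= delta * ln N%:R ->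
  l - delta <= free_energy mu beta (2 ^ k) w ->
  free_energy mu beta (2 ^ k.+1) w <= l + delta ->
  lnZ (2 ^ k) w <= lnZ N w + delta * ln N%:R ->
  lnZ N w <= lnZ (2 ^ k.+1) w + delta * ln N%:R ->
  `|l - free_energy mu beta N w| <= 3 * delta.
Proof.
move=> N4 d0 k big lo up c1 c2.
have ln20 : 0 < ln (2 : R) by apply: ln_gt0; rewrite ltr1n.
have l0 := limit_free_energy_ge0.
have k1 : (2 ^ k <= N)%N by apply: trunc_logP => //; apply: leq_trans N4.
have k2 : (N < 2 ^ k.+1)%N by exact: trunc_log_ltn.
have N0 : 0 < N%:R :> R by rewrite ltr0n; apply: leq_trans N4.
have LN : 0 < ln N%:R :> R by apply: ln_gt0; rewrite ltr1n; apply: leq_trans N4.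
have p2 j : 0 < (2 ^ j)%:R :> R by rewrite ltr0n expn_gt0.
have K1 : k%:R * ln 2 <= ln N%:R :> R.
  by rewrite -ln_dyadic ler_ln ?posrE// ler_nat.
have K2 : ln N%:R <= k.+1%:R * ln 2 :> R.
  by rewrite -ln_dyadic ler_ln ?posrE// ler_nat ltnW.
have kpos : 0 < k%:R :> R by rewrite ltr0n trunc_log_gt0/=; apply: leq_trans N4.
have kk : k.+1%:R = k%:R + 1 :> R by rewrite -natr1.
move: lo; rewrite /free_energy -/(partition_sum mu beta _ w) ler_pdivlMl ?ln_dyadic ?mulr_gt0// -/(lnZ _ _) => lo.
move: up; rewrite /free_energy -/(partition_sum mu beta _ w) ler_pdivrMl ?ln_dyadic ?mulr_gt0// -/(lnZ _ _) => up.
rewrite kk in up K2.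
rewrite /free_energy -/(partition_sum mu beta _ w) -/(lnZ _ _).
set A := k%:R * ln 2 in lo up K1 K2.
set B := lnZ N w in c1 c2 *.
set L := ln N%:R in LN K1 K2 big c1 c2 *.
have A2 : (k%:R + 1) * ln 2 = A + ln 2 by rewrite /A; ring.
rewrite A2 in up K2.
have lA := ler_wpM2l l0 K1.
have lA2 := ler_wpM2l l0 K2.
have dA := ler_wpM2l (ltW d0) K1.
have d2 : 0 < delta * ln 2 by rewrite mulr_gt0.
have -> : l - L^-1 * B = (l * L - B) / L by field; rewrite gt_eqF.
rewrite normrM normfV (gtr0_norm LN) ler_pdivrMr// ler_norml.
apply/andP; split; lra.
Qed.

Lemma free_energy_near (delta : R) : 0 < delta ->
  {ae P, forall w, \forall N \near \oo, `|l - free_energy mu beta N w| <= 3 * delta}.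
Proof.
move=> d0.
have e0 : 0 < delta / beta by rewrite divr_gt0.
have be : beta * (delta / beta) = delta by rewrite mulrC divfK// gt_eqF.
have h1 := poly_small_dyadic (upper_tail hmu hbeta d0).
have h2 := poly_small_dyadic (lower_tail hmu hbeta d0).
have pr1 n : (4 < n)%N -> [/\ (0 < 2 ^ trunc_log 2 n)%N, (2 ^ trunc_log 2 n <= n)%N,
    (n <= 2 * 2 ^ trunc_log 2 n)%N, (2 ^ trunc_log 2 n <= n)%N & (4 < n)%N].
  move=> n4; have n0 : (0 < n)%N by apply: leq_trans n4.
  by split; rewrite ?expn_gt0 ?trunc_logP// -expnS ltnW// trunc_log_ltn.
have pr2 n : (4 < n)%N -> [/\ (0 < n)%N, (n <= 2 ^ (trunc_log 2 n).+1)%N,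
    (2 ^ (trunc_log 2 n).+1 <= 2 * n)%N, (n <= n)%N & (4 < 2 ^ (trunc_log 2 n).+1)%N].
  move=> n4; have n0 : (0 < n)%N by apply: leq_trans n4.
  split => //.
  - by rewrite ltnW// trunc_log_ltn.
  - by rewrite expnS leq_mul2l trunc_logP.
  - by apply: (leq_trans n4); rewrite ltnW// trunc_log_ltn.
have h3 := compare_ae hmu hbeta e0 pr1.
have h4 := compare_ae hmu hbeta e0 pr2.
have h34 : {ae P, forall w,
    (\forall n \near \oo, ln (partition_sum mu beta (2 ^ trunc_log 2 n) w) <=
      ln (partition_sum mu beta n w) + beta * (delta / beta * ln n%:R)) /\
    (\forall n \near \oo, ln (partition_sum mu beta n w) <=
      ln (partition_sum mu beta (2 ^ (trunc_log 2 n).+1) w) +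
      beta * (delta / beta * ln n%:R))}.
  by move: h3 h4; apply: filterS2.
move: h1 h2 h34; apply: filterS3 => w [k1 _ w1] [k2 _ w2] [w3 w4].
near=> N.
have c1 : ln (partition_sum mu beta (2 ^ trunc_log 2 N) w) <=
      ln (partition_sum mu beta N w) + beta * (delta / beta * ln N%:R) by near: N; exact: w3.
have c2 : ln (partition_sum mu beta N w) <=
      ln (partition_sum mu beta (2 ^ (trunc_log 2 N).+1) w) + beta * (delta / beta * ln N%:R) by near: N; exact: w4.
have N4 : (4 < N)%N by near: N; exact: nbhs_infty_gt.
have big : (l + delta) * ln 2 / delta <= ln N%:R by near: N; exact: ln_nat_large.
have Nk : (2 ^ maxn k1 k2 <= N)%N by near: N; exact: nbhs_infty_ge.
have kk := trunc_log_max (isT : (1 < 2)%N) Nk.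
rewrite mulrA be in c1; rewrite mulrA be in c2.
apply: (free_energy_dyadic N4 d0) => //.
- by move: big; rewrite ler_pdivrMr// [leRHS]mulrC.
- rewrite leNgt; apply/negP; apply: w2 => /=.
  by apply: leq_trans kk; exact: leq_maxr.
- rewrite leNgt; apply/negP; apply: w1 => /=.
  by apply: leqW; apply: leq_trans kk; exact: leq_maxl.
Unshelve. all: by end_near. Qed.

Lemma free_energy_cvg_as : cvg_almost_surely P (free_energy mu beta) l.
Proof.
have : {ae P, forall w, forall j : nat, \forall N \near \oo,
    `|l - free_energy mu beta N w| <= 3 * j.+1%:R^-1}.
  by apply: ae_foralln => j; apply: free_energy_near; rewrite invr_gt0.
apply: filterS => w hw; apply/cvgrPdist_le => eps e0.
have e3 : 0 < eps / 3 by rewrite divr_gt0.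
have [j hj] : exists j : nat, j.+1%:R^-1 <= eps / 3 :> R.
  exists (Num.truncn (eps / 3)^-1).
  have i0 : 0 <= (eps / 3)^-1 by rewrite invr_ge0 ltW.
  have /andP[_ h] := truncn_itv i0.
  by rewrite -[leRHS]invrK lef_pV2 ?posrE ?invr_gt0// ltW.
apply: filterS (hw j) => N /le_trans; apply.
by rewrite mulrC -ler_pdivlMr.
Qed.

End AlmostSure.

(** * Convergence in mean *)

Section IntegralBound.
Context (R : realType) (d : measure_display) (T : measurableType d)
        (P : probability T R).

(** Bundles the measurability and positivity that every manipulation of the integral
asks for. *)
Definition mean_le (f : T -> R) (a : R) :=
  [/\ measurable_fun setT f, forall w, 0 <= f w & (\int[P]_w (f w)%:E <= a%:E)%E].

Lemma mean_leD (f g : T -> R) (a b : R) : mean_le f a -> mean_le g b ->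
  mean_le (fun w => f w + g w) (a + b).
Proof.
move=> [mf f0 fa] [mg g0 gb]; split.
- exact: measurable_funD.
- by move=> w; rewrite addr_ge0.
- under eq_integral do rewrite EFinD.
  rewrite ge0_integralD//.
  + by rewrite EFinD; exact: leeD.
  + by move=> w _; rewrite lee_fin.
  + exact/measurable_EFinP.
  + by move=> w _; rewrite lee_fin.
  + exact/measurable_EFinP.
Qed.

Lemma mean_leZ (f : T -> R) (a c : R) : 0 <= c -> mean_le f a ->
  mean_le (fun w => c * f w) (c * a).
Proof.
move=> c0 [mf f0 fa]; split.
- exact: (measurableT_comp (@mulrl_measurable R setT c)).
- by move=> w; rewrite mulr_ge0.
- under eq_integral do rewrite EFinM.
  rewrite ge0_integralZl//.
  + by rewrite EFinM lee_wpmul2l// lee_fin.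
  + exact/measurable_EFinP.
  + by move=> w _; rewrite lee_fin.
Qed.

Lemma mean_le_cst (c : R) : 0 <= c -> mean_le (fun=> c) c.
Proof.
move=> c0; split => //.
by rewrite integral_cst//= probability_setT mule1.
Qed.

Lemma mean_le_indic (A : set T) (a : R) : measurable A -> (P A <= a%:E)%E ->
  mean_le (\1_A) a.
Proof.
move=> mA PA; split => //.
by rewrite integral_indic// setIT.
Qed.

Lemma mean_le_trans (f g : T -> R) (a b : R) : measurable_fun setT f ->
  (forall w, 0 <= f w <= g w) -> a <= b -> mean_le g a -> mean_le f b.
Proof.
move=> mf fg ab [mg g0 ga]; split => //.
  by move=> w; have /andP[] := fg w.
apply: (@le_trans _ _ a%:E); last by rewrite lee_fin.
apply: le_trans ga; apply: ge0_le_integral => //=.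
- by move=> w _; rewrite lee_fin; have /andP[] := fg w.
- exact/measurable_EFinP.
- exact/measurable_EFinP.
- by move=> w _; rewrite lee_fin; have /andP[] := fg w.
Qed.

End IntegralBound.

Section L1.
Context (R : realType) (d : measure_display) (T : measurableType d)
        (P : probability T R).
Notation RR := (measurableTypeR R).
Context (mu : set (RR * RR) -> T -> R) (hmu : gaussian_random_measure P mu).
Context (beta : R) (hbeta : 0 < beta).

Let l := limit_free_energy beta.
Let b1 := beta_cut beta.
Let a := 1 + b1 ^+ 2 / 2.

(** From 1 + t <= exp t at t = s x and at t = - s x. *)
Lemma norm_le_expR (s x : R) : 0 < s ->
  `|x| <= s^-1 * (expR (s * x) + expR (- s * x)).
Proof.
move=> s0; rewrite mulrC ler_pdivlMr//.
have h1 := expR_ge1Dx (s * x); have h2 := expR_ge1Dx (- s * x).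
have e1 := expR_ge0 (s * x); have e2 := expR_ge0 (- s * x).
rewrite -(gtr0_norm s0) -normrM (gtr0_norm s0) ler_norml.
apply/andP; split; lra.
Qed.

(** The three terms correspond to f_N above its limit, f_N slightly below it, and the
event where it is far below.  The first uses ln z <= z with z = Z(b1) N^-a; in the
last case the sum Z(beta) is bounded below by a single term. *)
Lemma free_energy_dist (N : nat) (delta : R) (i : 'I_N) (w : T) : (1 < N)%N -> 0 < delta ->
  `|free_energy mu beta N w - l| <=
    (beta / b1 / ln N%:R) * (expR (- (a * ln N%:R)) * partition_sum mu b1 N w) +
    (delta + (l * \1_[set w | free_energy mu beta N w < l - delta] w +
     (beta / ln N%:R) * `|omega mu N%:R^-1 (site R i) w|)).
Proof.
move=> N1 d0.
have b10 : 0 < b1 by exact: beta_cut_gt0.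
have N0 : (0 < N)%N by exact: ltnW.
have L0 : 0 < ln N%:R :> R by apply: ln_gt0; rewrite ltr1n.
have l0 : 0 <= l by exact: limit_free_energy_ge0.
set Z := partition_sum mu b1 N w.
have Z0 : 0 < Z by exact: partition_sum_gt0.
have t1 : 0 <= (beta / b1 / ln N%:R) * (expR (- (a * ln N%:R)) * Z).
  by rewrite mulr_ge0 ?divr_ge0 ?ltW// mulr_gt0// expR_gt0.
have t3 : 0 <= l * \1_[set w | free_energy mu beta N w < l - delta] w.
  by rewrite mulr_ge0.
have t4 : 0 <= (beta / ln N%:R) * `|omega mu N%:R^-1 (site R i) w|.
  by rewrite mulr_ge0// divr_ge0 ?ltW.
have [fl|fl] := leP l (free_energy mu beta N w).
  rewrite ger0_norm ?subr_ge0//.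
  have h1 := ln_partition_sum_le mu hbeta w N0.
  have h2 : free_energy mu beta N w - l <= (beta / b1 / ln N%:R) * (ln Z - a * ln N%:R).
    rewrite /free_energy -/(partition_sum mu beta N w) /l limit_free_energyE// -/b1 -/a.
    have -> : beta / b1 / ln N%:R * (ln Z - a * ln N%:R) =
      (ln N%:R)^-1 * (beta / b1 * ln Z) - beta / b1 * a by field; rewrite !gt_eqF.
    by rewrite lerD2r ler_pM2l ?invr_gt0.
  have h3 : ln Z - a * ln N%:R <= expR (- (a * ln N%:R)) * Z.
    have := ln_sublinear (mulr_gt0 (expR_gt0 (- (a * ln N%:R))) Z0).
    rewrite lnM ?posrE ?expR_gt0// expRK => /ltW; lra.
  have h4 : 0 <= beta / b1 / ln N%:R by rewrite !divr_ge0 ?ltW.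
  have := ler_wpM2l h4 h3; lra.
rewrite ltr0_norm ?subr_lt0// opprB.
have [fd|fd] := leP (l - delta) (free_energy mu beta N w); first by lra.
have -> : \1_[set w | free_energy mu beta N w < l - delta] w = 1 :> R.
  by rewrite indicE mem_set.
have : - ((beta / ln N%:R) * `|omega mu N%:R^-1 (site R i) w|) <= free_energy mu beta N w.
  have -> : - ((beta / ln N%:R) * `|omega mu N%:R^-1 (site R i) w|) =
      (ln N%:R)^-1 * (beta * - `|omega mu N%:R^-1 (site R i) w|) by ring.
  rewrite /free_energy -/(partition_sum mu beta N w) ler_pM2l ?invr_gt0//.
  rewrite -ler_expR lnK ?posrE ?partition_sum_gt0//.
  rewrite /partition_sum (bigD1 i)//=.
  apply: ler_wpDr; first by apply: sumr_ge0 => j _; exact: expR_ge0.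
  rewrite ler_expR ler_pM2l//.
  by rewrite lerNl; apply: le_trans (ler_norm _) _; rewrite normrN.
lra.
Qed.

(** The field at one site has variance at most 1 + ln N; the exponential moment of
order 1/sqrt(ln N) bounds its mean absolute value by a multiple of
sqrt(ln N). *)
Lemma L1_bound (delta : R) : 0 < delta -> \forall N \near \oo,
  mean_le P (fun w => `|free_energy mu beta N w - l|) (4 * delta).
Proof.
move=> d0.
have b10 : 0 < b1 by exact: beta_cut_gt0.
have l0 : 0 <= l by exact: limit_free_energy_ge0.
have [C [c [C0 c0 hbad]]] := lower_tail hmu hbeta d0.
(* Beyond K1, K2 and K3 the three terms other than delta in the bound are each at
most delta. *)
pose K1 := beta / b1 * expR (b1 ^+ 2 / 2) / delta.
pose K2 := - (ln (delta / ((l + 1) * (C + 1))) / c).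
pose K3 := (2 * beta * expR 1 / delta) ^+ 2.
near=> N.
have N1 : (1 < N)%N by near: N; exact: nbhs_infty_gt.
have L1 : 1 <= ln N%:R :> R by near: N; exact: ln_nat_large.
have LK1 : K1 <= ln N%:R by near: N; exact: ln_nat_large.
have LK2 : K2 <= ln N%:R by near: N; exact: ln_nat_large.
have LK3 : K3 <= ln N%:R by near: N; exact: ln_nat_large.
have [mB PB] : measurable [set w | free_energy mu beta N w < l - delta] /\
    (P [set w | free_energy mu beta N w < l - delta]%R <= (C * expR (- c * ln N%:R))%:E)%E by near: N.
set L := ln N%:R in L1 LK1 LK2 LK3 PB *.
have L0 : 0 < L by lra.
pose i := Ordinal (ltnW N1).
have m1 : mean_le P (fun w => (beta / b1 / L) * (expR (- (a * L)) * partition_sum mu b1 N w))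
    (beta / b1 / L * (expR (- (a * L)) * expR (a * L + b1 ^+ 2 / 2))).
  apply: mean_leZ; first by rewrite !divr_ge0 ?ltW.
  apply: mean_leZ; first exact: expR_ge0.
  split.
  - exact: (measurable_partition_sum hmu).
  - by move=> w; apply/ltW/partition_sum_gt0; exact: ltnW.
  - exact: (expectation_partition_sum hmu).
have m2 : mean_le P (fun w => l * \1_[set w | free_energy mu beta N w < l - delta] w)
    (l * (C * expR (- c * L))).
  by apply: mean_leZ => //; exact: mean_le_indic.
have s0 : 0 < (Num.sqrt L)^-1 by rewrite invr_gt0 sqrtr_gt0.
have sL : (Num.sqrt L)^-1 ^+ 2 = L^-1 by rewrite exprVn sqr_sqrtr// ltW.
have mX (s : R) : s ^+ 2 = L^-1 ->
    mean_le P (fun w => expR (s * omega mu N%:R^-1 (site R i) w)) (expR 1).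
  move=> s2; split.
  - apply: (measurableT_comp (@measurable_expR R)).
    apply: (measurableT_comp (@mulrl_measurable R setT s)).
    by apply: (grm_measurable hmu); exact: omega_finite.
  - by move=> w; exact: expR_ge0.
  - apply: (le_trans (mu_mgf hmu s (omega_finite R i) (omega_theta R i N1))).
    rewrite lee_fin ler_expR -/L s2 mulrDr mulr1 mulVf ?gt_eqF//.
    have : L^-1 <= 1 by rewrite invf_le1.
    lra.
have m3 : mean_le P (fun w => (beta / L) * `|omega mu N%:R^-1 (site R i) w|)
    (beta / L * (Num.sqrt L * (expR 1 + expR 1))).
  apply: mean_leZ; first by rewrite divr_ge0 ?ltW.
  have := mean_leZ (ltW (_ : 0 < (Num.sqrt L)^-1^-1))
    (mean_leD (mX _ sL) (mX (- (Num.sqrt L)^-1) _)).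
  rewrite sqrrN sL invr_gt0 invrK => /(_ s0 erefl).
  apply: mean_le_trans => //.
    apply: measurableT_comp => //.
    by apply: (grm_measurable hmu); exact: omega_finite.
  move=> w; rewrite normr_ge0/=.
  by have := norm_le_expR (omega mu N%:R^-1 (site R i) w) s0; rewrite invrK.
have mD := mean_leD m1 (mean_leD (mean_le_cst P (ltW d0)) (mean_leD m2 m3)).
apply: (mean_le_trans _ _ _ mD).
- apply: measurableT_comp => //; apply: measurable_funB => //.
  exact: (measurable_free_energy hmu).
- by move=> w; rewrite normr_ge0/=; exact: free_energy_dist.
- have b1e : beta / b1 / L * (expR (- (a * L)) * expR (a * L + b1 ^+ 2 / 2)) <= delta.
    rewrite -expRD addKr mulrAC ler_pdivrMr//.
    by move: LK1; rewrite /K1 ler_pdivrMr// [leRHS]mulrC.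
  have b2e : l * (C * expR (- c * L)) <= delta.
    have lC : 0 < (l + 1) * (C + 1) by rewrite mulr_gt0//; lra.
    have xq : expR (- c * L) <= delta / ((l + 1) * (C + 1)).
      rewrite -[leRHS]lnK ?posrE ?divr_gt0// ler_expR mulNr lerNl [leRHS]mulrC.
      by move: LK2; rewrite /K2 -mulNr ler_pdivrMr.
    rewrite mulrA; apply: (@le_trans _ _ ((l + 1) * (C + 1) * expR (- c * L))).
      by rewrite ler_pM2r ?expR_gt0//; nra.
    by rewrite mulrC -ler_pdivlMr.
  have b3e : beta / L * (Num.sqrt L * (expR 1 + expR 1)) <= delta.
    have t0 : 0 < Num.sqrt L by rewrite sqrtr_gt0.
    have t2 : Num.sqrt L ^+ 2 = L by rewrite sqr_sqrtr// ltW.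
    have k3 : 2 * beta * expR 1 / delta <= Num.sqrt L.
      rewrite -ler_sqr ?nnegrE ?sqrtr_ge0 ?t2//.
      by rewrite divr_ge0 ?(ltW d0)// mulr_ge0 ?expR_ge0// mulr_ge0// ltW.
    have -> : beta / L * (Num.sqrt L * (expR 1 + expR 1)) = 2 * beta * expR 1 / Num.sqrt L.
      by rewrite -[X in beta / X]t2; field; rewrite gt_eqF.
    by move: k3; rewrite !ler_pdivrMr// [leRHS]mulrC.
  lra.
Unshelve. all: by end_near. Qed.

Lemma free_energy_cvg_L1 : cvg_L1 P (free_energy mu beta) l.
Proof.
have l0 : 0 <= l by exact: limit_free_energy_ge0.
split.
  near=> N.
  have : mean_le P (fun w => `|free_energy mu beta N w - l|) (4 * 1).
    by near: N; exact: L1_bound.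
  move=> /mean_leD /(_ (mean_le_cst P l0)) h.
  have mf : measurable_fun setT (free_energy mu beta N).
    exact: (measurable_free_energy hmu).
  apply/integrableP; split; first exact/measurable_EFinP.
  have [_ _ hb] : mean_le P (fun w => `|free_energy mu beta N w|) (4 * 1 + l).
    apply: (mean_le_trans _ _ (lexx _) h); first exact: measurableT_comp.
    move=> w; rewrite normr_ge0/=.
    have := ler_normD (free_energy mu beta N w - l) l.
    by rewrite subrK (ger0_norm l0).
  by apply: le_lt_trans hb _; exact: ltry.
have E0 N : (0%R <= 'E_P[fun w => `|free_energy mu beta N w - l|%R])%E.
  exact: expectation_ge0.
have EB delta : 0 < delta -> \forall N \near \oo,
    ('E_P[fun w => `|free_energy mu beta N w - l|%R] <= (4 * delta)%:E)%E.
  move=> d0; apply: filterS (L1_bound d0) => N [_ _]; by rewrite unlock.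
apply/fine_cvgP; split.
  apply: filterS (EB 1 ltr01) => N h.
  by rewrite ge0_fin_numE//; apply: le_lt_trans h _; exact: ltry.
apply/cvgrPdist_le => eps e0.
have e4 : 0 < eps / 4 by rewrite divr_gt0.
apply: filterS (EB _ e4) => N h /=.
rewrite sub0r normrN ger0_norm ?fine_ge0//.
rewrite -lee_fin fineK; first by rewrite mulrC divfK in h.
by rewrite ge0_fin_numE//; apply: le_lt_trans h _; exact: ltry.
Unshelve. all: by end_near. Qed.

End L1.

Theorem corollary1p3 (R : realType) (d : measure_display)
    (T : measurableType d) (P : probability T R)
    (mu : set (measurableTypeR R * measurableTypeR R) -> T -> R)
    (hmu : gaussian_random_measure P mu) (beta : R) (hbeta : 0 < beta) :
  cvg_almost_surely P (free_energy mu beta) (limit_free_energy beta) /\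
  cvg_L1 P (free_energy mu beta) (limit_free_energy beta).
Proof.
by split; [exact: free_energy_cvg_as|exact: free_energy_cvg_L1].
Qed.
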